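(* Let $\theta=\{\theta_x : x\in T\}$ be a permanental process with kernel $\Gamma$ satisfying $\sup_{x\in T}\Gamma(x,x)<\infty$, and let $$d(x,y)=4\sqrt{2/3}\,\Bigl(\Gamma(x,x)+\Gamma(y,y)-2\bigl(\Gamma(x,y)\Gamma(y,x)\bigr)^{1/2}\Bigr)^{1/2}.$$ Let $d_1$ be a metric or pseudometric on $T$ that dominates $d$, i.e. $d(x,y)\le d_1(x,y)$ for all $x,y\in T$, and such that $(T,d_1)$ is separable and has finite diameter. Equip $T$ with the $d_1$-topology. Suppose there exists a probability measure $\mu$ on the Borel $\sigma$-algebra of $(T,d_1)$ such that $$\lim_{\delta\to 0}J_{d_1}(\delta)=0 .$$ Then there exists a version $\theta'=\{\theta'_x : x\in T\}$ of $\theta$ that is bounded and continuous on $(T,d_1)$ almost surely and satisfies $$\lim_{\delta\to0}\ \sup_{\substack{s,t\in T\\ d_1(s,t)\le\delta}}\frac{|\theta'_s-\theta'_t|}{J_{d_1}(d_1(s,t)/2)}\le 60\Bigl(\sup_{x\in T}\theta'_x\Bigr)^{1/2}\qquad\text{a.s.}$$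
   Context: A permanental process with kernel $\Gamma:T\times T\to\mathbb{R}$ is a real-valued nonnegative stochastic process $\theta=\{\theta_x,x\in T\}$ such that for all $n$, all $x_1,\dots,x_n\in T$ and all $\alpha_1,\dots,\alpha_n\ge 0$, $$E\Bigl(\exp\Bigl(-\tfrac12\sum_{i=1}^n\alpha_i\theta_{x_i}\Bigr)\Bigr)=\frac{1}{|I+\alpha\Gamma|^{1/2}},$$ where $|\cdot|$ is the determinant, $I$ is the $n\times n$ identity, $\alpha=\mathrm{diag}(\alpha_1,\dots,\alpha_n)$ and $\Gamma=\{\Gamma(x_i,x_j)\}_{i,j=1}^n$ ($\Gamma$ need not be symmetric or positive definite). For such kernels $\Gamma(x,x)\ge0$ and $0\le\Gamma(x,y)\Gamma(y,x)\le\Gamma(x,x)\Gamma(y,y)$ for all $x,y$, so $d$ is well defined; $d$ is not assumed to be a metric. $B_{d_1}(t,u)=\{s\in T: d_1(s,t)\le u\}$, and for the probability measure $\mu$, $$J_{d_1}(a)=J_{T,d_1,\mu}(a)=\sup_{t\in T}\int_0^a\Bigl(\log\frac{1}{\mu(B_{d_1}(t,u))}\Bigr)^{1/2}du .$$ Convention: $0/0=0$. A version of $\theta$ is a process $\theta'$ on the same probability space with $P(\theta'_x=\theta_x)=1$ for each $x\in T$. *)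

(* Defs.v *)
From HB Require Import structures.
From mathcomp Require Import all_boot all_order all_algebra.
From mathcomp Require Import all_classical all_reals all_analysis.

Set Implicit Arguments.
Unset Strict Implicit.
Unset Printing Implicit Defensive.

Import Order.TTheory GRing.Theory Num.Theory.
Import numFieldNormedType.Exports.

Local Open Scope classical_set_scope.
Local Open Scope ring_scope.

Section permanental.
Context {dO : measure_display} {Omega : measurableType dO} {R : realType}.
Context {P : probability Omega R} {T : Type}.

Definition permanental_process (Gamma : T -> T -> R)
    (theta : T -> {RV P >-> R}) : Prop :=
  (forall x w, 0 <= theta x w) /\
  (forall (n : nat) (x : 'I_n -> T) (alpha : 'rV[R]_n),
    (forall i, 0 <= alpha ord0 i) ->
    'E_P[fun w => expR (- (2^-1 * \sum_(i < n) alpha ord0 i * theta (x i) w))]%E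
    = ((Num.sqrt (\det (1%:M + diag_mx alpha *m
          \matrix_(i < n, j < n) Gamma (x i) (x j))))^-1)%:E).

Definition version_of (theta theta' : T -> {RV P >-> R}) : Prop :=
  forall x, (P [set w | theta' x w = theta x w] = 1)%E.

End permanental.

Definition permanental_dist {R : realType} {T : Type} (Gamma : T -> T -> R)
    (x y : T) : R :=
  4 * Num.sqrt (2 / 3) *
  Num.sqrt (Gamma x x + Gamma y y - 2 * Num.sqrt (Gamma x y * Gamma y x)).

Definition is_pseudometric {R : realType} {T : Type} (d1 : T -> T -> R) : Prop :=
  [/\ forall x y, 0 <= d1 x y,
      forall x, d1 x x = 0,
      forall x y, d1 x y = d1 y x &
      forall x y z, d1 x z <= d1 x y + d1 y z].

(* A pseudoPMetricType carries balls but no distance function;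
   this says that the balls, hence the topology, of T are those of d1. *)
Definition induces_balls {R : realType} {T : pseudoPMetricType R}
    (d1 : T -> T -> R) : Prop :=
  forall (x : T) (e : R), 0 < e -> ball x e = [set y | d1 x y < e].

Definition separable (T : topologicalType) : Prop :=
  exists2 D : set T, countable D & dense D.

Definition diameter {R : realType} {T : Type} (d1 : T -> T -> R) : \bar R :=
  ereal_sup [set (d1 p.1 p.2)%:E | p in [set: T * T]].

Definition borel_space (T : ptopologicalType) := g_sigma_algebraType (@open T).

Definition dball {R : realType} {T : Type} (d1 : T -> T -> R) (t : T) (u : R) :
  set T := [set s | d1 s t <= u].

(* Extended-real valued: the integrand is +oo where the ball is mu-null. *)
Definition majorizing_integral {R : realType} {T : pseudoPMetricType R}
    (d1 : T -> T -> R) (mu : probability (borel_space T) R) (a : R) : \bar R :=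
  (ereal_sup [set \int[lebesgue_measure]_(u in `[0%R, a])
                    sqrte (lne (1 / mu (dball d1 t u))) | t in [set: T]])%E.

(* In \bar R, 0 / 0 = 0 * +oo = 0, and c / 0 = +oo for c > 0. *)
Definition increment_ratio_sup {R : realType} {T : pseudoPMetricType R}
    (d1 : T -> T -> R) (mu : probability (borel_space T) R) (f : T -> R)
    (delta : R) : \bar R :=
  ereal_sup [set (`|f p.1 - f p.2|%:E /
                  majorizing_integral d1 mu (d1 p.1 p.2 / 2))%E
            | p in [set p : T * T | d1 p.1 p.2 <= delta]].

(* Main.v *)
Require Import Defs.
From HB Require Import structures.
From mathcomp Require Import all_boot all_order all_algebra.
From mathcomp Require Import all_classical all_reals all_analysis.
From mathcomp Require Import measurable_realfun.
From mathcomp Require Import ring lra.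

(** For two points x, y the pair (theta_x, theta_y) has the Laplace transform of the
    squares of a Gaussian pair whose increment has variance
    s2 = Gamma(x,x) + Gamma(y,y) - 2 (Gamma(x,y) Gamma(y,x))^(1/2), hence it has that law.
    So the increments of X = theta^(1/2) are dominated by Gaussian ones, and
    exp (4 (X_x - X_y)^2 / d1(x,y)^2) has mean at most 4.

    A Garsia-Rodemich-Rumsey argument turns this into a path property.  Averages of X
    over two sets A and B of weights w(A), w(B) and mutual distance at most D differ by
    at most (D/2) (log (Y / (w(A) w(B))))^(1/2), where Y is the double sum of the above
    exponentials.  Chaining along balls of halving radii gives
    |X_s - X_t| <= 18 J(d1(s,t)/2) + K d1(s,t), with K random.  To avoid a measurable
    version of X, the measure mu is replaced by weights on finite nets; by Fatou's lemma
    the corresponding Y stay bounded along a random subsequence of nets.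

    As positive distances d1(s,t) tend to 0, J(d1(s,t)/2)/d1(s,t) tends to infinity, so
    that K d1 is absorbed and |X_s - X_t| <= 30 J(d1(s,t)/2) for close s, t in a dense
    sequence.  The version theta' extends X^2 by continuity, and the constant 60 comes
    from |X_s^2 - X_t^2| <= 2 |X_s - X_t| sup X. *)

Set SsrOldRewriteGoalsOrder.
Set Implicit Arguments.
Unset Strict Implicit.
Unset Printing Implicit Defensive.

Import Order.TTheory GRing.Theory Num.Theory.
Import numFieldNormedType.Exports.

Local Open Scope classical_set_scope.
Local Open Scope ring_scope.

(** * Gaussian integrals *)

(** The Radon-Nikodym derivative of the normal law agrees almost everywhere with [normal_pdf], since
    both have the same integral over every measurable set. *)
Lemma ge0_integral_normal_prob (R : realType) (f : R -> \bar R) :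
  measurable_fun setT f -> (forall x, (0 <= f x)%E) ->
  (\int[normal_prob (0:R) 1]_x f x =
   \int[lebesgue_measure]_x (f x * (normal_pdf 0 1 x)%:E))%E.
Proof.
move=> mf f0.
have dom := @normal_prob_dominates R 0 1.
rewrite -(Radon_Nikodym_SigmaFinite.change_of_variables dom)//.
have mpdf : measurable_fun [set: R] (fun x => (normal_pdf (0:R) 1 x)%:E).
  by apply/measurable_EFinP; exact: measurable_normal_pdf.
have RNint := Radon_Nikodym_SigmaFinite.f_integrable dom.
apply: ae_eq_integral => //.
- apply: emeasurable_funM => //.
  exact: (measurable_int lebesgue_measure).
- exact: emeasurable_funM.
- apply: ae_eqe_mul2l => /=.
  apply: integral_ae_eq => //=.
  move=> E _ mE.
  by rewrite -(Radon_Nikodym_SigmaFinite.f_integral dom).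
Qed.

(* Completing the square turns the integrand into a multiple of a Gaussian density. *)
Lemma integral_normal_prob_expR_sqr (R : realType) (a b c : R) :
  0 < 1 + a * c ^+ 2 ->
  (\int[normal_prob (0:R) 1]_z (expR (- (a / 2 * (b + c * z) ^+ 2)))%:E =
   ((Num.sqrt (1 + a * c ^+ 2))^-1 *
    expR (- (a * b ^+ 2 / (2 * (1 + a * c ^+ 2)))))%:E)%E.
Proof.
move=> q0; set q := 1 + a * c ^+ 2 in q0 *.
have sq0 : 0 < Num.sqrt q by rewrite sqrtr_gt0.
have mf : measurable_fun [set: R]
    (fun z : R => (expR (- (a / 2 * (b + c * z) ^+ 2)))%:E).
  apply/measurable_EFinP; apply: measurableT_comp => //.
  apply: measurableT_comp => //; apply: measurable_funM => //.
  by apply: measurable_funX; apply: measurable_funD => //; exact: measurable_funM.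
rewrite ge0_integral_normal_prob//.
set C := _ * expR _.
(* Mean and standard deviation of the Gaussian density left after completing the square. *)
pose m := - (a * b * c / q); pose s := (Num.sqrt q)^-1.
have s0 : s != 0 by rewrite gt_eqF// invr_gt0.
transitivity (\int[lebesgue_measure]_x (C%:E * (normal_pdf m s x)%:E))%E.
  apply: eq_integral => x _; rewrite -!EFinM; congr EFin.
  rewrite !normal_pdfE ?oner_neq0//.
  rewrite /normal_peak /normal_fun /C.
  have -> : (Num.sqrt (1 ^+ 2 * pi *+ 2))^-1 =
      (Num.sqrt q)^-1 * (Num.sqrt (s ^+ 2 * pi *+ 2))^-1 :> R.
    rewrite -invfM -sqrtrM ?ltW//; congr (Num.sqrt _)^-1.
    rewrite /s exprVn sqr_sqrtr ?ltW//.
    by field; rewrite gt_eqF.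
  rewrite mulrCA [RHS]mulrACA; congr (_ * _).
  rewrite -!expRD; congr expR.
  rewrite /s /m exprVn sqr_sqrtr ?ltW//.
  have qn : q != 0 by rewrite gt_eqF.
  have c2E : a * c ^+ 2 = q - 1 by rewrite /q; ring.
  apply: (mulIf qn); apply: (mulIf (x := 2)) => //.
  transitivity (- (a * (b + c * x) ^+ 2 * q + x ^+ 2 * q)).
    by field.
  transitivity (- ((q * x + a * b * c) ^+ 2 + a * b ^+ 2)); last first.
    by field; rewrite qn.
  rewrite /q; ring.
rewrite ge0_integralZl//.
- by rewrite integral_normal_pdf mule1.
- by apply/measurable_EFinP; exact: measurable_normal_pdf.
- by move=> x _; rewrite lee_fin normal_pdf_ge0.
- by rewrite lee_fin mulr_ge0// ?invr_ge0 ?expR_ge0.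
Qed.

(** * Laplace transforms of pairs of nonnegative random variables *)

(* As a polynomial in [u], this is the mean of [g] under the binomial law of
   parameters [n] and [u]; the recursion conditions on the first trial. *)
Fixpoint bernstein {R : realType} (n : nat) (g : nat -> R) : {poly R} :=
  if n is n'.+1 then
    (1 - 'X) * @bernstein R n' g + 'X * @bernstein R n' (fun k => g k.+1)
  else (g 0%N)%:P.

Lemma horner_bernsteinS (R : realType) n (g : nat -> R) u :
  (bernstein n.+1 g).[u] =
  (1 - u) * (bernstein n g).[u] + u * (bernstein n (fun k => g k.+1)).[u].
Proof. by rewrite /= !hornerE. Qed.

Lemma le_bernstein (R : realType) n (g h : nat -> R) u :
  0 <= u <= 1 -> (forall k, g k <= h k) ->
  (bernstein n g).[u] <= (bernstein n h).[u].
Proof.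
move=> /andP[u0 u1]; elim: n g h => [|n IH] g h gh; first by rewrite !hornerE.
rewrite !horner_bernsteinS lerD// ler_wpM2l ?subr_ge0//; exact: IH.
Qed.

Lemma bernstein_cst (R : realType) n (c u : R) :
  (bernstein n (fun=> c)).[u] = c.
Proof.
by elim: n => [|n IH]; [rewrite /= hornerE|rewrite horner_bernsteinS IH; ring].
Qed.

Lemma bernstein_affine (R : realType) n (g : nat -> R) (c e u : R) :
  (bernstein n (fun k => c + e * g k)).[u] = c + e * (bernstein n g).[u].
Proof.
elim: n g => [|n IH] g; first by rewrite /= !hornerE.
by rewrite !horner_bernsteinS (IH g) (IH (fun k => g k.+1)); ring.
Qed.

(** Variance plus squared bias for the binomial law. In the recursion a success in the first trial
    shifts [c] to [c - 1]. *)
Lemma bernstein_variance (R : realType) n (c u : R) :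
  (bernstein n (fun k => (k%:R - c) ^+ 2)).[u] =
  n%:R * u * (1 - u) + (n%:R * u - c) ^+ 2.
Proof.
elim: n c => [|n IH] c; first by rewrite /= !hornerE.
rewrite horner_bernsteinS IH.
have -> : (fun k => (k.+1%:R - c) ^+ 2) = (fun k => (k%:R - (c - 1)) ^+ 2).
  by apply/funext => k; rewrite -natr1; congr (_ ^+ 2); ring.
by rewrite IH -natr1; ring.
Qed.

(** Bernstein's proof of the Weierstrass theorem. The degree is a square so that the binomial
    frequency has a standard deviation of order [N.+1%:R^-1]. *)
Lemma bernstein_approx (R : realType) (f : R -> R) (L : R) (N : nat) (u : R) :
  0 <= L -> (forall x y, `|f x - f y| <= L * `|x - y|) -> 0 <= u <= 1 ->
  `|(bernstein (N.+1 * N.+1) (fun k => f (k%:R / (N.+1 * N.+1)%:R))).[u] - f u|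
    <= 2 * L / N.+1%:R.
Proof.
move=> L0 fL u01; set n := (N.+1 * N.+1)%N.
have nE : n%:R = N.+1%:R ^+ 2 :> R by rewrite /n natrM expr2.
have N0 : (0 : R) < N.+1%:R by rewrite ltr0n.
set M : R := N.+1%:R in nE N0 *.
(* The sign [s] treats both halves of the absolute value at once. *)
have key (s : R) : s \in [:: 1; -1] ->
  s * ((bernstein n (fun k => f (k%:R / n%:R))).[u] - f u) <= 2 * L / M.
  move=> s1.
  have -> : s * ((bernstein n (fun k => f (k%:R / n%:R))).[u] - f u) =
      (bernstein n (fun k => - s * f u + s * f (k%:R / n%:R))).[u].
    by rewrite bernstein_affine; ring.
  (* The deviation [x] is replaced by the quadratic [M^-1 + M * x ^+ 2], whose binomial mean is
     known exactly. *)
  apply: (@le_trans _ _ (bernstein n (fun k =>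
      L / M + L / M ^+ 3 * (k%:R - n%:R * u) ^+ 2)).[u]).
    apply: le_bernstein => // k.
    have h : - s * f u + s * f (k%:R / n%:R) <= `|f (k%:R / n%:R) - f u|.
      apply: le_trans (ler_norm _) _.
      have -> : - s * f u + s * f (k%:R / n%:R) = s * (f (k%:R / n%:R) - f u) by ring.
      by move: s1; rewrite !inE => /orP[] /eqP ->; rewrite normrM ?normrN normr1 mul1r.
    apply: le_trans h _; apply: le_trans (fL _ _) _.
    set x := `|_|.
    have -> : L / M + L / M ^+ 3 * (k%:R - n%:R * u) ^+ 2 =
        L * (M^-1 + M * x ^+ 2).
      rewrite /x real_normK ?num_real// nE; field; rewrite gt_eqF//.
    apply: ler_wpM2l => //.
    have : 0 <= (M * x - 1) ^+ 2 / M + x 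
      by apply: addr_ge0; [apply: divr_ge0; [exact: sqr_ge0|exact: ltW]|exact: normr_ge0].
    have -> : (M * x - 1) ^+ 2 / M + x = (M^-1 + M * x ^+ 2) - x.
      by field; rewrite gt_eqF.
    by rewrite subr_ge0.
  rewrite bernstein_affine bernstein_variance subrr expr0n addr0 nE.
  have -> : L / M + L / M ^+ 3 * (M ^+ 2 * u * (1 - u)) = (1 + u * (1 - u)) * L / M.
    by field; rewrite gt_eqF.
  rewrite ler_wpM2r ?invr_ge0 ?(ltW N0)// ler_wpM2r//.
  by case/andP: u01 => u0 u1; nra.
have h1 := key 1; have h2 := key (-1).
rewrite ler_norml; apply/andP; split.
  by rewrite lerNl -mulN1r; apply: h2; rewrite !inE eqxx orbT.
by rewrite -[X in X <= _]mul1r; apply: h1; rewrite !inE eqxx.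
Qed.

(** By linearity: boundedness makes every monomial integrable, so equal mixed moments suffice. *)
Lemma eq_integral_horner2 (R : realType) d1 d2 (O1 : measurableType d1)
    (O2 : measurableType d2) (P1 : probability O1 R) (P2 : probability O2 R)
    (U1 V1 : O1 -> R) (U2 V2 : O2 -> R) :
  measurable_fun setT U1 -> measurable_fun setT V1 ->
  measurable_fun setT U2 -> measurable_fun setT V2 ->
  (forall w, 0 <= U1 w <= 1) -> (forall w, 0 <= V1 w <= 1) ->
  (forall w, 0 <= U2 w <= 1) -> (forall w, 0 <= V2 w <= 1) ->
  (forall m n : nat, (\int[P1]_w (U1 w ^+ m * V1 w ^+ n)%:E =
    \int[P2]_w (U2 w ^+ m * V2 w ^+ n)%:E)%E) ->
  forall p q : {poly R}, (\int[P1]_w (p.[U1 w] * q.[V1 w])%:E =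
    \int[P2]_w (p.[U2 w] * q.[V2 w])%:E)%E.
Proof.
move=> mU1 mV1 mU2 mV2 U1b V1b U2b V2b H p q.
have main d (O : measurableType d) (P : probability O R) (U V : O -> R) :
    measurable_fun setT U -> measurable_fun setT V ->
    (forall w, 0 <= U w <= 1) -> (forall w, 0 <= V w <= 1) ->
    (\int[P]_w (p.[U w] * q.[V w])%:E =
     \sum_(i < size p) \sum_(j < size q)
       (p`_i * q`_j)%:E * \int[P]_w (U w ^+ i * V w ^+ j)%:E)%E.
  move=> mU mV Ub Vb.
  have int_mono i j : P.-integrable setT (EFin \o (fun w => U w ^+ i * V w ^+ j)).
    apply: measurable_bounded_integrable => //.
    - by apply: le_lt_trans (probability_le1 _ _) _; rewrite ?ltry.
    - by apply: measurable_funM; apply: measurable_funX.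
    - exists 1; split => // M M1 w _; apply: le_trans (ltW M1).
      have /andP[a b] := Ub w; have /andP[a' b'] := Vb w.
      rewrite ger0_norm ?mulr_ge0 ?exprn_ge0//.
      by rewrite -[leRHS]mulr1 ler_pM ?exprn_ge0// exprn_ile1.
  transitivity (\int[P]_w (\sum_(i < size p) \sum_(j < size q)
      ((p`_i * q`_j)%:E * (U w ^+ i * V w ^+ j)%:E)))%E.
    apply: eq_integral => w _; rewrite !horner_coef big_distrlr/=.
    rewrite -sumEFin; apply: eq_bigr => i _; rewrite -sumEFin.
    by apply: eq_bigr => j _; rewrite -EFinM; congr EFin; ring.
  rewrite integral_sum//; last first.
    move=> i; apply: integrable_sum => // j _.
    exact: integrableZl (int_mono i j).
  apply: eq_bigr => i _; rewrite integral_sum//; last first.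
    by move=> j; exact: integrableZl (int_mono i j).
  by apply: eq_bigr => j _; rewrite integralZl//; exact: int_mono.
rewrite main// main//.
by apply: eq_bigr => i _; apply: eq_bigr => j _; rewrite H.
Qed.

(** Both functions are replaced by Bernstein polynomials, uniformly on the unit interval. An
    inequality is enough, because the two spaces can be exchanged. *)
Lemma eq_integral_lipschitz2 (R : realType) d1 d2 (O1 : measurableType d1)
    (O2 : measurableType d2) (P1 : probability O1 R) (P2 : probability O2 R)
    (U1 V1 : O1 -> R) (U2 V2 : O2 -> R) (f g : R -> R) (L : R) :
  measurable_fun setT U1 -> measurable_fun setT V1 ->
  measurable_fun setT U2 -> measurable_fun setT V2 ->
  (forall w, 0 <= U1 w <= 1) -> (forall w, 0 <= V1 w <= 1) ->
  (forall w, 0 <= U2 w <= 1) -> (forall w, 0 <= V2 w <= 1) ->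
  measurable_fun setT f -> measurable_fun setT g ->
  (forall x, 0 <= f x <= 1) -> (forall x, 0 <= g x <= 1) ->
  0 <= L ->
  (forall x y, `|f x - f y| <= L * `|x - y|) ->
  (forall x y, `|g x - g y| <= L * `|x - y|) ->
  (forall p q : {poly R}, (\int[P1]_w (p.[U1 w] * q.[V1 w])%:E =
    \int[P2]_w (p.[U2 w] * q.[V2 w])%:E)%E) ->
  (\int[P1]_w (f (U1 w) * g (V1 w))%:E <= \int[P2]_w (f (U2 w) * g (V2 w))%:E)%E.
Proof.
move=> mU1 mV1 mU2 mV2 U1b V1b U2b V2b mf mg fb gb L0 fL gL H.
apply/lee_addgt0Pr => e e0.
(* The product of the two approximations errs by at most [2 * dl], once on each space, and [4 * dl]
   is this bound. *)
have [N HN] : exists N : nat, 8 * L / N.+1%:R <= e.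
  exists (Num.truncn (8 * L / e)); rewrite ler_pdivrMr ?ltr0n//.
  by rewrite [e * _]mulrC -ler_pdivrMr// ltW// truncnS_gt.
pose bern (h : R -> R) : {poly R} :=
  bernstein (N.+1 * N.+1) (fun k => h (k%:R / (N.+1 * N.+1)%:R : R)).
set dl := 2 * L / N.+1%:R in HN *.
have dl0 : 0 <= dl by rewrite divr_ge0// mulr_ge0.
have bern01 (h : R -> R) (u : R) :
    (forall x, 0 <= h x <= 1) -> 0 <= u <= 1 -> 0 <= (bern h).[u] <= 1.
  move=> hb ub; apply/andP; split.
    rewrite -{1}(bernstein_cst (N.+1 * N.+1) 0 u); apply: le_bernstein => // k.
    by case/andP: (hb (k%:R / (N.+1 * N.+1)%:R)).
  rewrite -[leRHS](bernstein_cst (N.+1 * N.+1) 1 u); apply: le_bernstein => // k.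
  by case/andP: (hb (k%:R / (N.+1 * N.+1)%:R)).
have close (u v : R) : 0 <= u <= 1 -> 0 <= v <= 1 ->
    `|(bern f).[u] * (bern g).[v] - f u * g v| <= 2 * dl.
  move=> ub vb; have hf := bernstein_approx N L0 fL ub.
  have hg := bernstein_approx N L0 gL vb.
  have := bern01 f u fb ub; have := bern01 g v gb vb.
  move: hf hg; rewrite -/(bern f) -/(bern g) -/dl.
  set F := (bern f).[u]; set G := (bern g).[v].
  move=> hF hG /andP[G0 G1] /andP[F0 F1]; have /andP[f0 f1] := fb u.
  have -> : F * G - f u * g v = (F - f u) * G + f u * (G - g v) by ring.
  apply: le_trans (ler_normD _ _) _; rewrite !normrM (ger0_norm G0) (ger0_norm f0).
  have -> : 2 * dl = dl * 1 + 1 * dl by ring.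
  by rewrite lerD// ler_pM.
have mbern d (O : measurableType d) (U V : O -> R) : measurable_fun setT U ->
    measurable_fun setT V ->
    measurable_fun setT (fun w => ((bern f).[U w] * (bern g).[V w])%:E).
  move=> mU mV; apply/measurable_EFinP; apply: measurable_funM.
    by apply: measurableT_comp => //; exact: measurable_poly.
  by apply: measurableT_comp => //; exact: measurable_poly.
have mfg d (O : measurableType d) (U V : O -> R) : measurable_fun setT U ->
    measurable_fun setT V -> measurable_fun setT (fun w => (f (U w) * g (V w))%:E).
  move=> mU mV; apply/measurable_EFinP; apply: measurable_funM;
  exact: measurableT_comp.
have fg0 (x y : R) : (0 <= (f x * g y)%:E)%E.
  by rewrite lee_fin; case/andP: (fb x) (gb y) => f0 _ /andP[g0 _]; rewrite mulr_ge0.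
have b0 (u v : R) : 0 <= u <= 1 -> 0 <= v <= 1 -> (0 <= ((bern f).[u] * (bern g).[v])%:E)%E.
  move=> ub vb; rewrite lee_fin mulr_ge0//.
    by case/andP: (bern01 f u fb ub).
  by case/andP: (bern01 g v gb vb).
have icst d (O : measurableType d) (P : probability O R) :
    (\int[P]_w (2 * dl)%:E = (2 * dl)%:E)%E.
  by rewrite integral_cst//= probability_setT mule1.
have dl20 : (0 <= (2 * dl)%:E)%E by rewrite lee_fin mulr_ge0.
apply: (@le_trans _ _ (\int[P1]_w (((bern f).[U1 w] * (bern g).[V1 w])%:E + (2 * dl)%:E))%E).
  apply: ge0_le_integral => //.
  - exact: mfg.
  - by apply: emeasurable_funD => //; exact: mbern.
  - move=> w _; rewrite -EFinD lee_fin -lerBlDl.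
    by apply: le_trans (ler_norm _) _; rewrite distrC; exact: close.
rewrite ge0_integralD//; [|by move=> w _; exact: b0|exact: mbern].
rewrite icst H.
apply: (@le_trans _ _ (\int[P2]_w ((f (U2 w) * g (V2 w))%:E + (2 * dl)%:E) + (2 * dl)%:E)%E).
  rewrite leeD2r//; apply: ge0_le_integral => //.
  - by move=> w _; exact: b0.
  - exact: mbern.
  - by apply: emeasurable_funD => //; exact: mfg.
  - move=> w _; rewrite -EFinD lee_fin -lerBlDl.
    by apply: le_trans (ler_norm _) _; exact: close.
rewrite ge0_integralD//; last exact: mfg.
rewrite icst -addeA leeD2l// -EFinD lee_fin.
by rewrite (_ : _ + _ = 8 * L / N.+1%:R)//; rewrite /dl; ring.
Qed.

(** Lipschitz functions that increase with [j] to the indicator of []a, +oo[]; they carry the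
    equality of means from Lipschitz functions to events. *)
Definition ramp {R : realType} (a : R) (j : nat) (x : R) : R :=
  Num.min 1 (Num.max 0 (j%:R * (x - a))).

Lemma ramp01 (R : realType) (a : R) j x : 0 <= ramp a j x <= 1.
Proof. by rewrite /ramp le_min ler01 le_max lexx/= ge_min lexx. Qed.

Lemma ramp_lipschitz (R : realType) (a : R) j x y :
  `|ramp a j x - ramp a j y| <= j%:R * `|x - y|.
Proof.
rewrite -[j%:R]ger0_norm// -normrM mulrBr.
have -> : j%:R * x - j%:R * y = j%:R * (x - a) - j%:R * (y - a) by ring.
rewrite /ramp; move: (j%:R * (x - a)) (j%:R * (y - a)) => u v {x y a}.
wlog uv : u v / u <= v.
  by move=> H; case: (leP u v) => [|/ltW] /H//; rewrite distrC [leRHS]distrC.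
rewrite distrC [leRHS]distrC !ger0_norm ?subr_ge0//; last first.
  rewrite le_min !ge_min lexx/=; apply/orP; right.
  by rewrite ge_max le_max lexx/= le_max uv orbT.
rewrite /Num.min /Num.max.
by case: (ltP 0 u) => u0; case: (ltP 0 v) => v0; rewrite ?ltr10;
  try (case: (ltP 1 u) => u1); try (case: (ltP 1 v) => v1); lra.
Qed.

Lemma measurable_ramp (R : realType) (a : R) j : measurable_fun setT (ramp a j).
Proof.
apply: measurable_minr => //; apply: measurable_maxr => //.
by apply: measurable_funM => //; exact: measurable_funB.
Qed.

Lemma cvg_ramp (R : realType) (a x : R) :
  (fun j => ramp a j x) @ \oo --> ((a < x)%R%:R : R).
Proof.
case: (ltP a x) => ax /=.
  apply: cvg_near_cst; near=> j.
  rewrite /ramp; apply/min_idPl.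
  rewrite le_max; apply/orP; right.
  rewrite -ler_pdivrMr ?subr_gt0//.
  near: j; exact: nbhs_infty_ger.
rewrite (_ : (fun _ => _) = cst 0); first exact: cvg_cst.
apply/funext => j; rewrite /ramp.
have -> : Num.max 0 (j%:R * (x - a)) = 0.
  by apply/max_idPl; rewrite mulr_ge0_le0// subr_le0.
by apply/min_idPr.
Unshelve. all: by end_near. Qed.

Lemma nondecreasing_ramp (R : realType) (a x : R) i j :
  (i <= j)%N -> ramp a i x <= ramp a j x.
Proof.
move=> ij; rewrite /ramp le_min ge_min lexx/= ge_min; apply/orP; right.
rewrite le_max !ge_max lexx/=; case: (leP 0 (x - a)) => xa.
  by apply/orP; right; rewrite mulr_ge0//= ler_wpM2r// ler_nat.
by apply/orP; left; rewrite mulr_ge0_le0// ltW.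
Qed.

Lemma cvg_integral_ramp2 (R : realType) d (O : measurableType d)
    (P : probability O R) (U V : O -> R) (a b : R) :
  measurable_fun setT U -> measurable_fun setT V ->
  ((\int[P]_w (ramp a j (U w) * ramp b j (V w))%:E) @[j --> \oo] -->
   P [set w | (a < U w)%R /\ (b < V w)%R])%E.
Proof.
move=> mU mV.
have mS : measurable [set w | a < U w /\ b < V w].
  rewrite (_ : mkset _ = U @^-1` `]a, +oo[ `&` V @^-1` `]b, +oo[).
    by apply: measurableI; rewrite -[X in measurable X]setTI; [exact: mU|exact: mV].
  by apply/seteqP; split => w /=; rewrite !in_itv/= !andbT.
rewrite (_ : P _ = (\int[P]_w limn (fun j => (ramp a j (U w) * ramp b j (V w))%:E))%E).
  apply: cvg_monotone_convergence => //.
  - move=> j; apply/measurable_EFinP; apply: measurable_funM.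
      by apply: measurableT_comp => //; exact: measurable_ramp.
    by apply: measurableT_comp => //; exact: measurable_ramp.
  - move=> j w _; rewrite lee_fin mulr_ge0//.
      by case/andP: (ramp01 a j (U w)).
    by case/andP: (ramp01 b j (V w)).
  - move=> w _ i j ij; rewrite lee_fin ler_pM ?nondecreasing_ramp//.
      by case/andP: (ramp01 a i (U w)).
    by case/andP: (ramp01 b i (V w)).
transitivity (\int[P]_w (\1_[set w | (a < U w)%R /\ (b < V w)%R] w)%:E)%E.
  by rewrite integral_indic// setIT.
apply: eq_integral => w _; apply/esym/cvg_lim => //.
apply: cvg_EFin; first by near=> j.
rewrite /comp/=.
have -> : \1_[set w0 | a < U w0 /\ b < V w0] w = (a < U w)%R%:R * (b < V w)%R%:R :> R.
  rewrite indicE -natrM mulnb; congr (nat_of_bool _)%:R.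
  by apply/idP/andP; rewrite inE.
by apply: cvgM; exact: cvg_ramp.
Unshelve. all: by end_near. Qed.

(** The substitution [e] sends the half-line to the unit interval and turns Laplace transforms at
    integer points into mixed moments. As [e] decreases, the events [X < a] become [e a < e X],
    which ramps approximate from below. *)
Lemma eq_laplace_rectangle (R : realType) d1 d2 (O1 : measurableType d1)
    (O2 : measurableType d2) (P1 : probability O1 R) (P2 : probability O2 R)
    (X1 Y1 : O1 -> R) (X2 Y2 : O2 -> R) :
  measurable_fun setT X1 -> measurable_fun setT Y1 ->
  measurable_fun setT X2 -> measurable_fun setT Y2 ->
  (forall w, 0 <= X1 w) -> (forall w, 0 <= Y1 w) ->
  (forall w, 0 <= X2 w) -> (forall w, 0 <= Y2 w) ->
  (forall m n : nat,
    (\int[P1]_w (expR (- (2^-1 * (m%:R * X1 w + n%:R * Y1 w))))%:E =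
     \int[P2]_w (expR (- (2^-1 * (m%:R * X2 w + n%:R * Y2 w))))%:E)%E) ->
  forall a b, P1 [set w | X1 w < a /\ Y1 w < b] = P2 [set w | X2 w < a /\ Y2 w < b].
Proof.
move=> mX1 mY1 mX2 mY2 X10 Y10 X20 Y20 H a b.
pose e (x : R) := expR (- (2^-1 * x)).
have me : measurable_fun setT e.
  by apply: measurableT_comp => //; apply: measurableT_comp => //; exact: measurable_funM.
have eb x : 0 <= x -> 0 <= e x <= 1.
  move=> x0; rewrite expR_ge0/= -[leRHS]expR0 ler_expR oppr_le0.
  by rewrite mulr_ge0// invr_ge0.
have lt_e (x y : R) : (e y < e x) = (x < y).
  by rewrite ltr_expR ltrN2 ltr_pM2l// invr_gt0.
have rectE d (O : measurableType d) (X Y : O -> R) :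
    [set w | X w < a /\ Y w < b] = [set w | e a < e (X w) /\ e b < e (Y w)].
  by apply/seteqP; split => w /=; rewrite !lt_e.
rewrite !rectE.
have HP := @eq_integral_horner2 _ _ _ _ _ P1 P2 (e \o X1) (e \o Y1) (e \o X2) (e \o Y2).
have := HP (measurableT_comp me mX1) (measurableT_comp me mY1)
  (measurableT_comp me mX2) (measurableT_comp me mY2)
  (fun w => eb _ (X10 w)) (fun w => eb _ (Y10 w))
  (fun w => eb _ (X20 w)) (fun w => eb _ (Y20 w)).
have eXY (x y : R) m n : e x ^+ m * e y ^+ n = expR (- (2^-1 * (m%:R * x + n%:R * y))).
  by rewrite /e -!expRM_natl -expRD; congr expR; ring.
move=> {}HP; have {}HP : forall p q : {poly R},
    (\int[P1]_w (p.[e (X1 w)] * q.[e (Y1 w)])%:E =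
     \int[P2]_w (p.[e (X2 w)] * q.[e (Y2 w)])%:E)%E.
  apply: HP => m n; under eq_integral do rewrite eXY.
  by under [RHS]eq_integral do rewrite eXY; exact: H.
have c1 := @cvg_integral_ramp2 _ _ _ P1 _ _ (e a) (e b)
  (measurableT_comp me mX1) (measurableT_comp me mY1).
have c2 := @cvg_integral_ramp2 _ _ _ P2 _ _ (e a) (e b)
  (measurableT_comp me mX2) (measurableT_comp me mY2).
have lip d3 d4 (O3 : measurableType d3) (O4 : measurableType d4)
    (P3 : probability O3 R) (P4 : probability O4 R) (X3 Y3 : O3 -> R)
    (X4 Y4 : O4 -> R) j :
    measurable_fun setT X3 -> measurable_fun setT Y3 ->
    measurable_fun setT X4 -> measurable_fun setT Y4 ->
    (forall w, 0 <= X3 w) -> (forall w, 0 <= Y3 w) ->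
    (forall w, 0 <= X4 w) -> (forall w, 0 <= Y4 w) ->
    (forall p q : {poly R}, \int[P3]_w (p.[e (X3 w)] * q.[e (Y3 w)])%:E =
      \int[P4]_w (p.[e (X4 w)] * q.[e (Y4 w)])%:E)%E ->
    (\int[P3]_w (ramp (e a) j (e (X3 w)) * ramp (e b) j (e (Y3 w)))%:E <=
     \int[P4]_w (ramp (e a) j (e (X4 w)) * ramp (e b) j (e (Y4 w)))%:E)%E.
  move=> mX3 mY3 mX4 mY4 X30 Y30 X40 Y40 H34.
  apply: (@eq_integral_lipschitz2 _ _ _ _ _ P3 P4 (e \o X3) (e \o Y3)
    (e \o X4) (e \o Y4) _ _ j%:R).
  - exact: measurableT_comp.
  - exact: measurableT_comp.
  - exact: measurableT_comp.
  - exact: measurableT_comp.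
  - by move=> w; exact: eb.
  - by move=> w; exact: eb.
  - by move=> w; exact: eb.
  - by move=> w; exact: eb.
  - exact: measurable_ramp.
  - exact: measurable_ramp.
  - exact: ramp01.
  - exact: ramp01.
  - exact: ler0n.
  - exact: ramp_lipschitz.
  - exact: ramp_lipschitz.
  - exact: H34.
have E : (fun j => \int[P1]_w (ramp (e a) j ((e \o X1) w) * ramp (e b) j ((e \o Y1) w))%:E)%E =
    (fun j => \int[P2]_w (ramp (e a) j ((e \o X2) w) * ramp (e b) j ((e \o Y2) w))%:E)%E.
  by apply/funext => j; apply/eqP; rewrite eq_le; apply/andP; split; apply: lip.
rewrite E in c1.
exact: (cvg_unique _ c1 c2).
Qed.

(** A half-plane is the union of the quadrants whose other bound runs through the integers, so
    quadrants make both projections measurable. *)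
Lemma measurable_prod_quadrant (R : realType) :
  @measurable _ (R * R)%type =
  <<s [set A `*` B | A in @RGenInftyO.G R & B in @RGenInftyO.G R] >>.
Proof.
set G := [set _ `*` _ | _ in _ & _ in _].
have GE (a b : R) : G (`]-oo, a[ `*` `]-oo, b[).
  by exists `]-oo, a[%classic; [exists a|exists `]-oo, b[%classic => //; exists b].
pose T := g_sigma_algebraType G.
have cover (x : R) : (\bigcup_n `]-oo, (n%:R : R)[%classic) x.
  by exists (Num.truncn x).+1 => //=; rewrite in_itv/= truncnS_gt.
have mfst : measurable_fun setT (fst : T -> R).
  apply: (measurability _ (RGenInftyO.measurableE R)) => _ [_ [a ->]] <-.
  rewrite setTI (_ : _ @^-1` _ = \bigcup_n (`]-oo, a[ `*` `]-oo, n%:R[)%classic).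
    by apply: bigcupT_measurable => n; apply: sub_sigma_algebra; exact: GE.
  apply/seteqP; split => [[x y] /= xa|[x y] [n _ []]//].
  by have [n _ yn] := cover y; exists n.
have msnd : measurable_fun setT (snd : T -> R).
  apply: (measurability _ (RGenInftyO.measurableE R)) => _ [_ [a ->]] <-.
  rewrite setTI (_ : _ @^-1` _ = \bigcup_n (`]-oo, n%:R[ `*` `]-oo, a[)%classic).
    by apply: bigcupT_measurable => n; apply: sub_sigma_algebra; exact: GE.
  apply/seteqP; split => [[x y] /= xa|[x y] [n _ []]//].
  by have [n _ yn] := cover x; exists n.
rewrite eqEsubset; split.
  apply: smallest_sub; first exact: smallest_sigma_algebra.
  by move=> _ [|] [B mB <-]; [exact: mfst|exact: msnd].
apply: smallest_sub; first exact: sigma_algebra_measurable.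
by move=> _ [_ [a ->]] [_ [b ->]] <-; apply: measurableX.
Qed.

(** Quadrants are stable under intersection, exhaust the plane and generate its sigma-algebra; two
    laws that agree on them coincide. *)
Lemma eq_laplace_ge0_integral (R : realType) d1 d2 (O1 : measurableType d1)
    (O2 : measurableType d2) (P1 : probability O1 R) (P2 : probability O2 R)
    (X1 Y1 : O1 -> R) (X2 Y2 : O2 -> R) (F : R * R -> \bar R) :
  measurable_fun setT X1 -> measurable_fun setT Y1 ->
  measurable_fun setT X2 -> measurable_fun setT Y2 ->
  (forall w, 0 <= X1 w) -> (forall w, 0 <= Y1 w) ->
  (forall w, 0 <= X2 w) -> (forall w, 0 <= Y2 w) ->
  (forall m n : nat,
    (\int[P1]_w (expR (- (2^-1 * (m%:R * X1 w + n%:R * Y1 w))))%:E =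
     \int[P2]_w (expR (- (2^-1 * (m%:R * X2 w + n%:R * Y2 w))))%:E)%E) ->
  measurable_fun setT F -> (forall z, (0 <= F z)%E) ->
  (\int[P1]_w F (X1 w, Y1 w) = \int[P2]_w F (X2 w, Y2 w))%E.
Proof.
move=> mX1 mY1 mX2 mY2 X10 Y10 X20 Y20 H mF F0.
have m1 := measurable_fun_pair mX1 mY1; have m2 := measurable_fun_pair mX2 mY2.
pose Z1 : {mfun O1 >-> (R * R)%type} := mfun_Sub (mem_set m1).
pose Z2 : {mfun O2 >-> (R * R)%type} := mfun_Sub (mem_set m2).
rewrite -[LHS]/(\int[P1]_w (F \o Z1) w)%E -[RHS]/(\int[P2]_w (F \o Z2) w)%E.
rewrite -(ge0_integral_distribution Z1)// -(ge0_integral_distribution Z2)//.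
apply: eq_measure_integral => A mA _.
apply: (measure_unique [set A `*` B | A in @RGenInftyO.G R & B in @RGenInftyO.G R]
  (fun n => `]-oo, n%:R[ `*` `]-oo, n%:R[)) => //.
- exact: measurable_prod_quadrant.
- move=> _ _ [_ [a ->]] [_ [b ->]] <- [_ [a' ->]] [_ [b' ->]] <-.
  exists `]-oo, Num.min a a'[%classic; first by eexists; reflexivity.
  exists `]-oo, Num.min b b'[%classic; first by eexists; reflexivity.
  apply/seteqP; split => [[x y]|[x y]] /=; rewrite !in_itv/= !lt_min.
    by move=> [/andP[? ?] /andP[? ?]].
  by move=> [[-> ->] [-> ->]].
- by move=> n; do 2 (eexists; first by exists n%:R; reflexivity).
- apply/seteqP; split => // -[x y] _.
  exists (maxn (Num.truncn x).+1 (Num.truncn y).+1) => //=; rewrite !in_itv/=; split.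
    by rewrite (lt_le_trans (truncnS_gt _))// ler_nat leq_maxl.
  by rewrite (lt_le_trans (truncnS_gt _))// ler_nat leq_maxr.
- move=> _ [_ [a ->]] [_ [b ->]] <-.
  exact: (eq_laplace_rectangle mX1 mY1 mX2 mY2 X10 Y10 X20 Y20 H a b).
- by move=> k; apply: le_lt_trans (probability_le1 _ _) _ => //; rewrite ?ltry//;
    exact: measurableX.
Qed.

(** * Permanental pairs *)

(** The one-dimensional formula is applied twice, by Tonelli. Negative [s] and [t] are allowed as
    long as the integrals converge, which later gives exponential moments. *)
Lemma integral_gaussian_pair (R : realType) (a b c s t : R) :
  0 < 1 + t * c ^+ 2 ->
  0 < 1 + t * c ^+ 2 + s * a ^+ 2 * (1 + t * c ^+ 2) + t * b ^+ 2 ->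
  (\int[normal_prob (0:R) 1 \x normal_prob (0:R) 1]_z
     (expR (- (2^-1 * (s * (a * z.1) ^+ 2 + t * (b * z.1 + c * z.2) ^+ 2))))%:E =
   ((Num.sqrt (1 + t * c ^+ 2 + s * a ^+ 2 * (1 + t * c ^+ 2) + t * b ^+ 2))^-1)%:E)%E.
Proof.
set q := 1 + t * c ^+ 2 => q0 D0.
have qn : q != 0 by rewrite gt_eqF.
have mlin (u v : R) d (T : measurableType d) (f g : T -> R) :
    measurable_fun setT f -> measurable_fun setT g ->
    measurable_fun setT (fun z => u * f z + v * g z).
  by move=> mf mg; apply: measurable_funD; exact: measurable_funM.
have mf : measurable_fun setT (fun z : R * R =>
    (expR (- (2^-1 * (s * (a * z.1) ^+ 2 + t * (b * z.1 + c * z.2) ^+ 2))))%:E).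
  apply/measurable_EFinP; apply: measurableT_comp => //.
  apply: measurableT_comp => //; apply: measurable_funM => //.
  apply: (mlin _ _); apply: measurable_funX; first exact: measurable_funM.
  exact: mlin.
rewrite fubini_tonelli1//.
(* The inner integral leaves a Gaussian factor with this coefficient in the outer variable. *)
pose k : R := s * a ^+ 2 + t * b ^+ 2 / q.
have k0 : 0 < 1 + k * 1 ^+ 2.
  have -> : 1 + k * 1 ^+ 2 = (q + s * a ^+ 2 * q + t * b ^+ 2) / q.
    by rewrite /k; field.
  by rewrite divr_gt0.
transitivity (\int[normal_prob (0:R) 1]_x ((Num.sqrt q)^-1%:E *
    (expR (- (k / 2 * (0 + 1 * x) ^+ 2)))%:E))%E.
  apply: eq_integral => x _; rewrite /fubini_F/=.
  transitivity (\int[normal_prob (0:R) 1]_y ((expR (- (s / 2 * (a * x) ^+ 2)))%:E *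
      (expR (- (t / 2 * (b * x + c * y) ^+ 2)))%:E))%E.
    apply: eq_integral => y _; rewrite -EFinM -expRD; congr (expR _)%:E.
    by field.
  rewrite ge0_integralZl//; last first.
    apply/measurable_EFinP; apply: measurableT_comp => //.
    apply: measurableT_comp => //; apply: measurable_funM => //.
    by apply: measurable_funX; exact: measurable_funD.
  rewrite integral_normal_prob_expR_sqr// -!EFinM mulrCA; congr (_ * _)%:E.
  by rewrite -expRD; congr expR; rewrite /k -/q; field.
rewrite ge0_integralZl//.
- rewrite integral_normal_prob_expR_sqr//.
  rewrite [_ * 0 ^+ 2]mulrC expr0n !mul0r oppr0 expR0 mulr1 -EFinM -invfM.
  rewrite -sqrtrM ?ltW//; congr (Num.sqrt _)^-1%:E.
  by rewrite /k; field.
- apply/measurable_EFinP; apply: measurableT_comp => //.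
  apply: measurableT_comp => //; apply: measurable_funM => //.
  by apply: measurable_funX; exact: measurable_funD.
Qed.

Lemma integral_expR_neq0 (R : realType) d (O : measurableType d)
    (P : probability O R) (X : O -> R) :
  measurable_fun setT X -> (\int[P]_w (expR (X w))%:E != 0)%E.
Proof.
move=> mX; apply/eqP => I0.
have mE : measurable_fun setT (fun w => (expR (X w))%:E).
  by apply/measurable_EFinP; exact: measurableT_comp.
have /(ae_eq_integral_abs P measurableT mE) : (\int[P]_w `|(expR (X w))%:E| = 0)%E.
  by rewrite -I0; apply: eq_integral => w _; rewrite gee0_abs// lee_fin expR_ge0.
move=> [N [mN N0 sub]].
have : P setT = 0%E.
  apply/eqP; rewrite eq_le measure_ge0 andbT -N0; apply: le_measure; rewrite ?inE//.
  apply: subset_trans sub => w _ /= /(_ I) /eqP.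
  by rewrite eqe gt_eqF// expR_gt0.
by rewrite probability_setT => -[] /eqP; rewrite oner_eq0.
Qed.

Lemma det_mx22 (R : comRingType) (M : 'M[R]_2) :
  \det M = M 0 0 * M 1 1 - M 0 1 * M 1 0.
Proof.
rewrite (expand_det_row _ 0) !big_ord_recl big_ord0 addr0.
rewrite /cofactor !det_mx11 !mxE/= expr0 expr1 mul1r mulN1r mulrN.
have -> : lift (0 : 'I_2) 0 = 1 by apply/val_inj.
have -> : lift (1 : 'I_2) 0 = 0 by apply/val_inj.
by [].
Qed.

Section permanental_pair.
Context (R : realType) (dO : measure_display) (Omega : measurableType dO)
  (P : probability Omega R) (T : Type) (Gamma : T -> T -> R)
  (theta : T -> {RV P >-> R}).
Hypothesis perm : permanental_process Gamma theta.

Lemma permanental_laplace2 (x y : T) (s t : R) : 0 <= s -> 0 <= t ->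
  (\int[P]_w (expR (- (2^-1 * (s * theta x w + t * theta y w))))%:E =
   ((Num.sqrt (1 + s * Gamma x x + t * Gamma y y +
       s * t * (Gamma x x * Gamma y y - Gamma x y * Gamma y x)))^-1)%:E)%E.
Proof.
move=> s0 t0; have [_ lap] := perm.
pose xs (i : 'I_2) := if i == 0 then x else y.
pose al : 'rV[R]_2 := \row_i (if i == 0 then s else t).
have := lap 2%N xs al; rewrite unlock => H.
transitivity (\int[P]_w (expR (- (2^-1 * \sum_(i < 2) al 0 i * theta (xs i) w)))%:E)%E.
  apply: eq_integral => w _; rewrite !big_ord_recl big_ord0 addr0 !mxE.
  by rewrite /xs/=.
rewrite H; last by move=> i; rewrite mxE; case: ifP.
congr (Num.sqrt _)^-1%:E; rewrite det_mx22 !mxE !big_ord_recl !big_ord0 !mxE/=.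
rewrite /xs/= !mulr1n !mulr0n; ring.
Qed.

(** At a nonpositive determinant the default values of [Num.sqrt] and of [0^-1] would make the
    Laplace transform zero, but the exponential has a nonzero mean. *)
Lemma permanental_det2_ge0 (x y : T) (s t : R) : 0 <= s -> 0 <= t ->
  0 < 1 + s * Gamma x x + t * Gamma y y +
       s * t * (Gamma x x * Gamma y y - Gamma x y * Gamma y x).
Proof.
move=> s0 t0; rewrite ltNge; apply/negP => D.
have := permanental_laplace2 x y s0 t0; rewrite ler0_sqrtr// invr0.
apply/eqP/integral_expR_neq0.
apply: measurableT_comp => //; apply: measurable_funM => //.
by apply: measurable_funD; apply: measurable_funM.
Qed.

(** If the entry were negative, [s = - (Gamma x x)^-1] and [t = 0] would be admissible and make the
    determinant vanish. *)
Lemma permanental_diag_ge0 x : 0 <= Gamma x x.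
Proof.
rewrite leNgt; apply/negP => g0.
have s0 : 0 <= - (Gamma x x)^-1 by rewrite oppr_ge0 invr_le0 ltW.
have := permanental_det2_ge0 x x s0 (lexx 0).
by rewrite mulNr mulVf ?lt_eqF// subrr !mul0r mulr0 mul0r !addr0 ltxx.
Qed.

Lemma permanental_offdiag_le x y :
  Gamma x y * Gamma y x <= Gamma x x * Gamma y y.
Proof.
rewrite -subr_ge0 leNgt; apply/negP; set D := _ - _ => D0.
have gx := permanental_diag_ge0 x; have gy := permanental_diag_ge0 y.
(* With [s = t] the determinant is quadratic with leading coefficient [D]. This [s] is large enough
   to bring it down to at most [1 - s], which is nonpositive. *)
pose s : R := 1 + (1 + Gamma x x + Gamma y y) / (- D).
have k0 : 0 <= (1 + Gamma x x + Gamma y y) / (- D).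
  by apply: divr_ge0; [rewrite !addr_ge0|rewrite oppr_ge0 ltW].
have s1 : 1 <= s by rewrite lerDl.
have s0 : 0 <= s by apply: le_trans s1.
have := permanental_det2_ge0 x y s0 s0; rewrite -/D.
have sD : s * D <= - (1 + Gamma x x + Gamma y y).
  have -> : s * D = D - (1 + Gamma x x + Gamma y y).
    by rewrite /s; field; rewrite lt_eqF.
  by rewrite gerDr ltW.
apply/negP; rewrite -leNgt -mulrA.
have := ler_wpM2l s0 sD; nra.
Qed.

(** The Laplace transform sees the off-diagonal entries only through their product, so the kernel
    may be symmetrized with the square root of that product. The numbers [a], [b], [c] form the
    Cholesky factor of the symmetrized matrix. *)
Lemma permanental_gaussian_pair x y : 0 <= Gamma x y * Gamma y x ->
  exists a b c : R, [/\ a ^+ 2 = Gamma x x, b ^+ 2 + c ^+ 2 = Gamma y y,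
    a * b = Num.sqrt (Gamma x y * Gamma y x) &
    forall F : R * R -> \bar R, measurable_fun setT F -> (forall z, (0 <= F z)%E) ->
    (\int[P]_w F (theta x w, theta y w) =
     \int[normal_prob (0:R) 1 \x normal_prob (0:R) 1]_z
       F ((a * z.1) ^+ 2, (b * z.1 + c * z.2) ^+ 2)%R)%E].
Proof.
move=> p0; have gx := permanental_diag_ge0 x; have gy := permanental_diag_ge0 y.
have pg := permanental_offdiag_le x y.
set p := Gamma x y * Gamma y x in p0 pg *.
pose a := Num.sqrt (Gamma x x); pose b := Num.sqrt p / a.
have a2 : a ^+ 2 = Gamma x x by rewrite sqr_sqrtr.
(* If [a = 0], the division gives [b = 0], and [permanental_offdiag_le] makes the root vanish as
   well. *)
have ab : a * b = Num.sqrt p.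
  have [a0|an] := eqVneq a 0; last by rewrite /b mulrCA mulfV// mulr1.
  rewrite a0 mul0r; apply/esym/eqP; rewrite sqrtr_eq0.
  by rewrite (le_trans pg)// -a2 a0 expr0n mul0r.
have b2 : b ^+ 2 <= Gamma y y.
  have [a0|an] := eqVneq a 0; first by rewrite /b a0 invr0 mulr0 expr0n.
  rewrite -(@ler_pM2l _ (a ^+ 2)); last by rewrite exprn_even_gt0.
  by rewrite -exprMn ab sqr_sqrtr// a2.
pose c := Num.sqrt (Gamma y y - b ^+ 2).
have c2 : c ^+ 2 = Gamma y y - b ^+ 2 by rewrite sqr_sqrtr// subr_ge0.
exists a, b, c; split => //; first by rewrite c2; ring.
move=> F mF F0.
have mlin (u v : R) : measurable_fun setT (fun z : R * R => u * z.1 + v * z.2).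
  by apply: measurable_funD; exact: measurable_funM.
apply: (@eq_laplace_ge0_integral _ _ _ _ _ P (normal_prob (0:R) 1 \x normal_prob (0:R) 1)%E
  (theta x) (theta y) (fun z => (a * z.1) ^+ 2) (fun z => (b * z.1 + c * z.2) ^+ 2) F) => //.
- by apply: measurable_funX; exact: measurable_funM.
- by apply: measurable_funX; exact: mlin.
- by have [+ _] := perm; apply.
- by have [+ _] := perm; apply.
- by move=> z; exact: sqr_ge0.
- by move=> z; exact: sqr_ge0.
move=> m n; rewrite permanental_laplace2// integral_gaussian_pair.
- congr (Num.sqrt _)^-1%:E; rewrite a2 c2.
  have -> : Gamma x x * Gamma y y - p = Gamma x x * (Gamma y y - b ^+ 2).
    by rewrite -[in LHS](sqr_sqrtr p0) -ab exprMn a2; ring.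
  ring.
- by rewrite ltr_pwDl// mulr_ge0// sqr_ge0.
- have h1 : 0 <= n%:R * c ^+ 2 by rewrite mulr_ge0// sqr_ge0.
  apply: ltr_wpDr; first by rewrite mulr_ge0// sqr_ge0.
  apply: ltr_wpDr; first by rewrite mulr_ge0 ?addr_ge0// mulr_ge0// sqr_ge0.
  by rewrite ltr_pwDl.
Qed.

(* If the off-diagonal product were negative, its square root would be the junk value
   [0], and the crude bound by the sum of the two marginals suffices. *)
Lemma permanental_sqrt_increment x y (lam : R) : 0 <= lam ->
  8 * lam * (Gamma x x + Gamma y y - 2 * Num.sqrt (Gamma x y * Gamma y x)) <= 3 ->
  (\int[P]_w (expR (lam * (Num.sqrt (theta x w) - Num.sqrt (theta y w)) ^+ 2))%:E
    <= 4%:E)%E.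
Proof.
move=> lam0 lam3.
have [th0 _] := perm.
have gx := permanental_diag_ge0 x; have gy := permanental_diag_ge0 y.
have msqrt : measurable_fun setT (@Num.sqrt R).
  by apply: continuous_measurable_fun; exact: sqrt_continuous.
have mexp d (O : measurableType d) (f : O -> R) : measurable_fun setT f ->
    measurable_fun setT (fun w => (expR (lam * f w))%:E).
  move=> mf; apply/measurable_EFinP; apply: measurableT_comp => //.
  exact: measurable_funM.
have [p0|p0] := leP 0 (Gamma x y * Gamma y x).
  have [a [b [c [a2 bc2 ab E]]]] := permanental_gaussian_pair p0.
  have mF : measurable_fun setT (fun z : R * R =>
      (expR (lam * (Num.sqrt z.1 - Num.sqrt z.2) ^+ 2))%:E).
    apply: mexp; apply: measurable_funX.
    by apply: measurable_funB; exact: measurableT_comp.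
  rewrite (E (fun z => (expR (lam * (Num.sqrt z.1 - Num.sqrt z.2) ^+ 2))%:E))//=.
  (* The roots of the squares are absolute values, which differ by no more than the Gaussians
     themselves. The parameters [0] and [- 2 * lam] turn the Laplace formula into an exponential
     moment of the increment. *)
  apply: (@le_trans _ _ (\int[normal_prob (0:R) 1 \x normal_prob (0:R) 1]_z
     (expR (- (2^-1 * (0 * (a * z.1) ^+ 2 +
        (- 2 * lam) * ((b - a) * z.1 + c * z.2) ^+ 2))))%:E)%E).
    have mlin (u v : R) : measurable_fun setT (fun z : R * R => u * z.1 + v * z.2).
      by apply: measurable_funD; exact: measurable_funM.
    apply: ge0_le_integral => //.
    - apply: mexp; apply: measurable_funX; apply: measurable_funB.
        apply: measurableT_comp => //; apply: measurable_funX.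
        exact: measurable_funM.
      by apply: measurableT_comp => //; apply: measurable_funX; exact: mlin.
    - apply/measurable_EFinP; apply: measurableT_comp => //.
      apply: measurableT_comp => //; apply: measurable_funM => //.
      apply: measurable_funD; apply: measurable_funM => //; apply: measurable_funX.
        exact: measurable_funM.
      exact: mlin.
    - move=> z _; rewrite lee_fin ler_expR !sqrtr_sqr.
      set u := a * z.1; set v := b * z.1 + c * z.2.
      have -> : - (2^-1 * (0 * u ^+ 2 + - 2 * lam * ((b - a) * z.1 + c * z.2) ^+ 2)) =
          lam * (u - v) ^+ 2 by rewrite /u /v; field.
      apply: ler_wpM2l => //; rewrite -[leRHS]real_normK ?num_real//.
      rewrite -[leLHS]real_normK ?num_real//.
      by apply: lerXn2r; rewrite ?nnegrE// ler_dist_dist.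
  have s2 : 8 * lam * (c ^+ 2 + (b - a) ^+ 2) <= 3.
    by apply: le_trans lam3; rewrite -ab -a2 -bc2 le_eqVlt; apply/orP; left; apply/eqP; ring.
  have c0 : 8 * lam * c ^+ 2 <= 3.
    apply: le_trans s2; rewrite ler_wpM2l ?lerDl ?sqr_ge0//.
    by rewrite mulr_ge0.
  rewrite integral_gaussian_pair; last 2 first.
  - lra.
  - lra.
  rewrite lee_fin.
  (* [D] is one minus [2 * lam] times the variance of the increment, hence at least 1/4, and the
     mean is at most 2. *)
  set D := (X in Num.sqrt X).
  have D4 : 2^-1 ^+ 2 <= D by rewrite /D; lra.
  have : 2^-1 <= Num.sqrt D.
    by rewrite -[leLHS](@ger0_norm R)// -sqrtr_sqr ler_wsqrtr.
  move=> h; apply: (@le_trans _ _ 2); last by lra.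
  by rewrite invf_ple ?posrE// (lt_le_trans _ h)// invr_gt0.
(* The law of a single value is read off the pair [(z, z)], whose off-diagonal product is a
   square. *)
have onevar z : 8 * lam * Gamma z z <= 3 ->
    (\int[P]_w (expR (lam * theta z w))%:E <= 2%:E)%E.
  move=> lz; have gz := permanental_diag_ge0 z.
  have [a [b [c [a2 _ _ E]]]] := permanental_gaussian_pair (mulr_ge0 gz gz).
  rewrite (E (fun u => (expR (lam * u.1))%:E))//=; last exact: mexp.
  have -> : (\int[normal_prob (0:R) 1 \x normal_prob (0:R) 1]_u
      (expR (lam * (a * u.1) ^+ 2))%:E = \int[normal_prob (0:R) 1 \x normal_prob (0:R) 1]_u
     (expR (- (2^-1 * ((- 2 * lam) * (a * u.1) ^+ 2 + 0 * (0 * u.1 + 0 * u.2) ^+ 2))))%:E)%E.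
    by apply: eq_integral => u _; congr (expR _)%:E; field.
  rewrite integral_gaussian_pair ?a2; last 2 first.
  - by rewrite mul0r addr0.
  - lra.
  rewrite lee_fin; set D := (X in Num.sqrt X).
  have D4 : 2^-1 ^+ 2 <= D by rewrite /D; lra.
  have h : 2^-1 <= Num.sqrt D.
    by rewrite -[leLHS](@ger0_norm R)// -sqrtr_sqr ler_wsqrtr.
  by rewrite invf_ple ?posrE// (lt_le_trans _ h)// invr_gt0.
rewrite ler0_sqrtr ?(ltW p0)// mulr0 subr0 in lam3.
have lx : 8 * lam * Gamma x x <= 3.
  by apply: le_trans lam3; rewrite ler_wpM2l ?mulr_ge0// lerDl.
have ly : 8 * lam * Gamma y y <= 3.
  by apply: le_trans lam3; rewrite ler_wpM2l ?mulr_ge0// lerDr.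
(* The roots are nonnegative, so their squared difference is at most the larger value; each marginal
   then contributes 2. *)
apply: (@le_trans _ _ (\int[P]_w ((expR (lam * theta x w))%:E + (expR (lam * theta y w))%:E))%E).
  apply: ge0_le_integral => //.
  - apply: mexp; apply: measurable_funX; apply: measurable_funB; exact: measurableT_comp.
  - by apply: emeasurable_funD; exact: mexp.
  - move=> w _; rewrite -EFinD lee_fin.
    have := th0 x w; have := th0 y w; move: (theta x w) (theta y w) => u v v0 u0.
    have su := sqr_sqrtr u0; have sv := sqr_sqrtr v0.
    have su0 := sqrtr_ge0 u; have sv0 := sqrtr_ge0 v.
    have [uv|/ltW vu] := leP u v.
      apply: (@le_trans _ _ (expR (lam * v))); last by rewrite lerDr expR_ge0.
      rewrite ler_expR ler_wpM2l// -[leRHS]sv; move: (ler_wsqrtr uv) su0 sv0.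
      by move: (Num.sqrt u) (Num.sqrt v) => ru rv; nra.
    apply: (@le_trans _ _ (expR (lam * u))); last by rewrite lerDl expR_ge0.
    rewrite ler_expR ler_wpM2l// -[leRHS]su; move: (ler_wsqrtr vu) su0 sv0.
    by move: (Num.sqrt u) (Num.sqrt v) => ru rv; nra.
rewrite ge0_integralD//; try by move=> w _; rewrite lee_fin expR_ge0.
- have -> : (4%:E = 2%:E + 2%:E :> \bar R)%E by rewrite -EFinD; congr EFin; ring.
  by apply: leeD; exact: onevar.
- exact: mexp.
- exact: mexp.
Qed.

End permanental_pair.

(** * The majorizing integral *)

Section nonincreasing_integral.
Context (R : realType) (f : R -> \bar R).
Hypothesis f0 : forall x, (0 <= f x)%E.
Hypothesis f_ni : forall x y, x <= y -> (f y <= f x)%E.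

(** The superlevel sets are intervals. *)
Lemma nonincreasing_emeasurable (D : set R) : measurable D -> measurable_fun D f.
Proof.
move=> mD; apply: (measurability _ (ErealGenCInfty.measurableE R)) => //.
move=> _ [_ [x ->]] <-; apply: measurableI => //.
apply: is_interval_measurable => s t /=; rewrite !in_itv/= !andbT => fs ft u /andP[su ut].
by rewrite in_itv/= andbT (le_trans ft)// f_ni.
Qed.

Let I (a : R) := (\int[lebesgue_measure]_(u in `[0%R, a]) f u)%E.

Lemma integral_nonincreasing_split (a b : R) : 0 <= a -> a <= b ->
  I b = (I a + \int[lebesgue_measure]_(u in `]a, b]) f u)%E.
Proof.
move=> a0 ab; rewrite /I -ge0_integral_setU//.
- congr (integral _ _ _); apply/seteqP; split => u /=; rewrite !in_itv/=.
    move=> /andP[u0 ub]; case: (leP u a) => ua; [left|right].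
      by rewrite u0.
    by rewrite ub.
  by move=> [/andP[-> ua]|/andP[au ->]]; rewrite ?(le_trans ua)// (le_trans a0 (ltW au)).
- apply: nonincreasing_emeasurable; exact: measurableU.
- apply/disj_setPS => u /=; rewrite !in_itv/= => -[/andP[_ ua] /andP[au _]].
  by move: (lt_le_trans au ua); rewrite ltxx.
Qed.

Lemma integral_nonincreasing_ge (a b : R) : 0 <= a -> a <= b ->
  (I a + (b - a)%:E * f b <= I b)%E.
Proof.
move=> a0 ab; rewrite (integral_nonincreasing_split a0 ab) leeD2l//.
apply: (@le_trans _ _ (\int[lebesgue_measure]_(u in `]a, b]) cst (f b) u)%E).
  rewrite integral_cst//= lebesgue_measure_itv/= lte_fin muleC.
  by move: ab; rewrite le_eqVlt => /orP[/eqP ->|->]; rewrite ?ltxx ?subrr ?mul0e// ?EFinB.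
apply: ge0_le_integral => //.
- by move=> u _ /=; exact: f0.
- exact: nonincreasing_emeasurable.
- by move=> u /=; rewrite in_itv/= => /andP[_ ub]; exact: f_ni.
Qed.

Lemma integral_nonincreasing_le (a b : R) : 0 <= a -> a <= b ->
  (I b <= I a + (b - a)%:E * f a)%E.
Proof.
move=> a0 ab; rewrite (integral_nonincreasing_split a0 ab) leeD2l//.
apply: (@le_trans _ _ (\int[lebesgue_measure]_(u in `]a, b]) cst (f a) u)%E).
  apply: ge0_le_integral => //.
  - exact: nonincreasing_emeasurable.
  - by move=> u /=; rewrite in_itv/= => /andP[/ltW au _]; exact: f_ni.
rewrite integral_cst//= lebesgue_measure_itv/= lte_fin muleC.
by move: ab; rewrite le_eqVlt => /orP[/eqP ->|->]; rewrite ?ltxx ?subrr ?mul0e// ?EFinB.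
Qed.

Lemma integral_nonincreasing0 : I 0 = 0%E.
Proof. by rewrite /I set_itv1 integral_set1. Qed.

End nonincreasing_integral.

Section majorizing.
Context (R : realType) (T : pseudoPMetricType R) (d : T -> T -> R)
  (mu : probability (borel_space T) R).
Hypothesis pm : is_pseudometric d.
Hypothesis ib : induces_balls d.

Let d_ge0 x y : 0 <= d x y. Proof. by case: pm. Qed.
Let d_refl x : d x x = 0. Proof. by case: pm. Qed.
Let d_sym x y : d x y = d y x. Proof. by case: pm. Qed.
Let d_tri x y z : d x z <= d x y + d y z. Proof. by case: pm. Qed.

Lemma open_dist_lt (x : T) (e : R) : open [set y | d x y < e].
Proof.
rewrite openE => y /= xy; apply/nbhs_ballP.
exists (e - d x y); first by rewrite /= subr_gt0.
rewrite ib ?subr_gt0// => z /= yz.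
by apply: le_lt_trans (d_tri x y z) _; rewrite -ltrBrDl.
Qed.

Lemma open_dist_gt (x : T) (e : R) : open [set y | e < d y x].
Proof.
rewrite openE => y /= xy; apply/nbhs_ballP.
exists (d y x - e); first by rewrite /= subr_gt0.
rewrite ib ?subr_gt0// => z /= yz.
by have := d_tri y z x; lra.
Qed.

Lemma measurable_dist_lt (x : T) (e : R) :
  measurable ([set y | d x y < e] : set (borel_space T)).
Proof. by apply: sub_sigma_algebra; exact: open_dist_lt. Qed.

Lemma measurable_dball (t : T) (u : R) :
  measurable (dball d t u : set (borel_space T)).
Proof.
rewrite (_ : dball d t u = ~` [set y | u < d y t]).
  by apply: measurableC; apply: sub_sigma_algebra; exact: open_dist_gt.
by apply/seteqP; split => y /=; rewrite /dball/= leNgt => /negP.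
Qed.

Definition ball_mass (t : T) (u : R) : R := fine (mu (dball d t u)).

Lemma ball_massE t u : mu (dball d t u) = (ball_mass t u)%:E.
Proof. by rewrite /ball_mass fineK// fin_num_measure//; exact: measurable_dball. Qed.

Lemma ball_mass_ge0 t u : 0 <= ball_mass t u.
Proof. by rewrite -lee_fin -ball_massE measure_ge0. Qed.

Lemma ball_mass_le1 t u : ball_mass t u <= 1.
Proof. by rewrite -lee_fin -ball_massE probability_le1//; exact: measurable_dball. Qed.

Lemma le_ball_mass t u v : u <= v -> ball_mass t u <= ball_mass t v.
Proof.
move=> uv; rewrite -lee_fin -!ball_massE le_measure ?inE//; try exact: measurable_dball.
by move=> s /= su; exact: le_trans su uv.
Qed.

Let h (t : T) (u : R) : \bar R := sqrte (lne (1 / mu (dball d t u)))%E.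
Let I (t : T) (a : R) := (\int[lebesgue_measure]_(u in `[0%R, a]) h t u)%E.
Let J := majorizing_integral d mu.

(** Equals the integrand of the majorizing integral only at balls of positive mass; at null balls
    that integrand is [+oo]. *)
Definition ball_entropy (t : T) (u : R) : R := Num.sqrt (- ln (ball_mass t u)).

Let hE t u : h t u = if 0 < ball_mass t u then (ball_entropy t u)%:E else +oo%E.
Proof.
rewrite /h ball_massE div1e; case: ltP => [m0|].
  by rewrite /ball_entropy inver gt_eqF// lne_EFin ?invr_gt0// lnV.
rewrite le_eqVlt ltNge ball_mass_ge0 orbF => /eqP ->.
by rewrite inver eqxx.
Qed.

Let h_ge0 t u : (0 <= h t u)%E. Proof. exact: sqrte_ge0. Qed.

Let h_ni t u v : u <= v -> (h t v <= h t u)%E.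
Proof.
move=> uv; rewrite !hE; have uv' := le_ball_mass t uv.
case: (ltP 0 (ball_mass t u)) => m0; last by rewrite leey.
have m0' := lt_le_trans m0 uv'; rewrite m0' lee_fin /ball_entropy.
by apply: ler_wsqrtr; rewrite lerN2 ler_ln ?posrE.
Qed.

Let IJ t a : (I t a <= J a)%E.
Proof. by apply: ereal_sup_ubound; exists t. Qed.

Let I_ge t a : 0 <= a -> (a%:E * h t a <= I t a)%E.
Proof.
move=> a0; have := integral_nonincreasing_ge (h_ge0 t) (@h_ni t) (lexx 0) a0.
by rewrite integral_nonincreasing0 add0e subr0.
Qed.

(** The average of a nonincreasing function over [[0, a]] does not increase with [a]. *)
Let I_scale t a b : 0 < a -> a <= b -> (I t b <= (b / a)%:E * I t a)%E.
Proof.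
move=> a0 ab.
apply: le_trans (integral_nonincreasing_le (h_ge0 t) (@h_ni t) (ltW a0) ab) _.
rewrite -/(I t a).
have -> : b / a = 1 + (b - a) / a by field; rewrite gt_eqF.
have ba0 : 0 <= (b - a) / a by rewrite divr_ge0 ?subr_ge0// ltW.
rewrite (EFinD 1) (ge0_muleDl (I t a)) ?lee_fin//.
rewrite mul1e leeD2l//.
apply: le_trans (lee_wpmul2l _ (I_ge t (ltW a0))); last by rewrite lee_fin.
by rewrite muleA -EFinM divfK// gt_eqF.
Qed.

Let J_scale a b : 0 < a -> a <= b -> (J b <= (b / a)%:E * J a)%E.
Proof.
move=> a0 ab; apply: ge_ereal_sup => _ [t _ <-].
apply: le_trans (I_scale t a0 ab) _; rewrite lee_wpmul2l//.
by rewrite lee_fin divr_ge0// ?(le_trans _ ab)// ltW.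
Qed.

Let J_ge0 a : (0 <= J a)%E.
Proof. by apply: le_trans (IJ point a); apply: integral_ge0 => u _; exact: h_ge0. Qed.

Let I_le t a b : a <= b -> (I t a <= I t b)%E.
Proof.
move=> ab; apply: ge0_subset_integral => //.
- by apply: nonincreasing_emeasurable => //; exact: h_ni.
- by apply: subset_itvl; rewrite bnd_simp.
Qed.

Lemma le_majorizing_integral a b : a <= b -> (J a <= J b)%E.
Proof.
move=> ab; apply: ge_ereal_sup => _ [t _ <-].
by apply: le_trans (I_le t ab) _; exact: IJ.
Qed.

Hypothesis Jcvg : majorizing_integral d mu delta @[delta --> 0^'+] --> 0%E.

Let Jsmall e : 0 < e -> exists2 dl, 0 < dl & (J dl <= e%:E)%E.
Proof.
move=> e0.
have : \forall dl \near (0:R)^'+, (J dl < e%:E)%E.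
  apply: (@Jcvg (fun x => (x < e%:E)%E)).
  by apply: open_ereal_lt'; rewrite lte_fin.
move=> near1.
have near2 : \forall dl \near (0:R)^'+, 0 < dl by exact: nbhs_right_gt.
have [dl [dl0 dle]] := filter_ex (filterI near2 near1).
by exists dl => //; exact: ltW.
Qed.

(** Convergence gives finiteness near zero, and scaling carries it to every [a]. *)
Lemma majorizing_integral_lty a : (J a < +oo)%E.
Proof.
have [dl dl0 Jdl] := Jsmall ltr01.
have [adl|/ltW dla] := leP a dl.
  by apply: le_lt_trans (le_majorizing_integral adl) _; apply: le_lt_trans Jdl _; rewrite ltry.
apply: le_lt_trans (J_scale dl0 dla) _.
apply: (@le_lt_trans _ _ ((a / dl)%:E * 1%:E)%E); last by rewrite -EFinM ltry.
by rewrite lee_wpmul2l// lee_fin divr_ge0// ltW// (lt_le_trans dl0).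
Qed.

(** A null ball of radius [u] would make the integrand infinite on all of [[0, u]]. *)
Lemma ball_mass_gt0 t u : 0 < u -> 0 < ball_mass t u.
Proof.
move=> u0; have := le_lt_trans (le_trans (I_ge t (ltW u0)) (IJ t u)) (majorizing_integral_lty u).
by rewrite hE; case: (ltP 0 (ball_mass t u)) => // _; rewrite gt0_muley ?lte_fin.
Qed.

Definition entropy_integral (t : T) (a : R) : R := fine (I t a).
Definition majorizing_bound (a : R) : R := fine (J a).
Local Notation L := ball_entropy.
Local Notation Ir := entropy_integral.
Local Notation Jr := majorizing_bound.

Lemma majorizing_boundE a : majorizing_integral d mu a = (Jr a)%:E.
Proof. by rewrite fineK// ge0_fin_numE// majorizing_integral_lty. Qed.

Let IrE t a : I t a = (Ir t a)%:E.
Proof.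
rewrite fineK// ge0_fin_numE; last by apply: integral_ge0 => u _; exact: h_ge0.
by apply: le_lt_trans (IJ t a) _; exact: majorizing_integral_lty.
Qed.

Let hL t u : 0 < u -> h t u = (L t u)%:E.
Proof. by move=> u0; rewrite hE ball_mass_gt0. Qed.

Lemma entropy_integral_halve t a : 0 < a ->
  a / 2 * L t a + Ir t (a / 2) <= Ir t a.
Proof.
move=> a0; have a20 : 0 <= a / 2 by rewrite divr_ge0// ltW.
have a2a : a / 2 <= a by lra.
have := integral_nonincreasing_ge (h_ge0 t) (@h_ni t) a20 a2a.
rewrite -!/(I t _) !IrE hL// -EFinM -EFinD lee_fin addrC.
by have -> : a - a / 2 = a / 2 by field.
Qed.

Lemma entropy_integral_ge t a : 0 < a -> a * L t a <= Ir t a.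
Proof. by move=> a0; have := I_ge t (ltW a0); rewrite IrE hL// -EFinM lee_fin. Qed.

Lemma entropy_integral_le t a : Ir t a <= Jr a.
Proof. by have := IJ t a; rewrite IrE /J majorizing_boundE lee_fin. Qed.

Lemma majorizing_bound_ge0 a : 0 <= Jr a.
Proof. by rewrite -lee_fin -majorizing_boundE; exact: J_ge0. Qed.

Lemma le_majorizing_bound a b : a <= b -> Jr a <= Jr b.
Proof. by move=> /le_majorizing_integral; rewrite /J !majorizing_boundE lee_fin. Qed.

Lemma majorizing_bound_scale a b : 0 < a -> a <= b -> Jr b <= b / a * Jr a.
Proof.
by move=> a0 ab; have := J_scale a0 ab; rewrite /J !majorizing_boundE -EFinM lee_fin.
Qed.

Lemma majorizing_bound_small e : 0 < e -> exists2 dl, 0 < dl & Jr dl <= e.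
Proof.
move=> /Jsmall[dl dl0 Jdl]; exists dl => //.
by rewrite -lee_fin -majorizing_boundE.
Qed.

Lemma majorizing_bound0 : Jr 0 = 0.
Proof.
apply/eqP; rewrite eq_le majorizing_bound_ge0 andbT; apply/ler_addgt0Pr => e e0.
have [dl dl0 h1] := majorizing_bound_small e0.
by rewrite add0r; apply: le_trans h1; apply: le_majorizing_bound; exact: ltW.
Qed.

Lemma ball_entropy_ge0 t u : 0 <= L t u. Proof. exact: sqrtr_ge0. Qed.

Lemma ball_entropy_sqr t u : L t u ^+ 2 = - ln (ball_mass t u).
Proof. by rewrite sqr_sqrtr// oppr_ge0 ln_le0// ball_mass_le1. Qed.

Lemma ball_mass_ge t u c : 0 < u -> L t u <= c -> expR (- c ^+ 2) <= ball_mass t u.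
Proof.
move=> u0 Lc; rewrite -[leRHS]lnK ?posrE ?ball_mass_gt0// ler_expR lerNl -ball_entropy_sqr.
by apply: lerXn2r => //; rewrite nnegrE ?(le_trans _ Lc)// ball_entropy_ge0.
Qed.

(** The supremum in [J] bounds [e * L t e] uniformly in the centre [t]. *)
Lemma ball_mass_unif e : 0 < e -> exists2 q, 0 < q & forall t, q <= ball_mass t e.
Proof.
move=> e0; exists (expR (- (Jr e / e) ^+ 2)); first exact: expR_gt0.
move=> t; apply: ball_mass_ge => //; rewrite ler_pdivlMr// mulrC.
exact: le_trans (entropy_integral_ge t e0) (entropy_integral_le t e).
Qed.

(** Balls of radius [e / 2] have mass at least some [q], while finitely many such balls around the
    sequence already cover more than [1 - q]. Hence every ball of radius [e / 2] meets one of
    these. *)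
Lemma majorizing_finite_net (z : nat -> T) :
  (forall t e, 0 < e -> exists i, d t (z i) < e) ->
  forall e, 0 < e -> exists N : nat, forall t, exists2 i, (i < N)%N & d t (z i) < e.
Proof.
move=> zd e e0; have e20 : 0 < e / 2 by rewrite divr_gt0.
have [q q0 hq] := ball_mass_unif e20.
pose F (n : nat) : set (borel_space T) := \bigcup_(i in `I_n) [set y | d (z i) y < e / 2].
have mF n : measurable (F n).
  by apply: bigcup_measurable => i _; exact: measurable_dist_lt.
have UF : \bigcup_n F n = setT.
  apply/seteqP; split => // t _; have [i hi] := zd t _ e20.
  by exists i.+1 => //; exists i => /=; rewrite // d_sym.
have : (mu (F n) @[n --> \oo] --> mu (\bigcup_n F n))%E.
  apply: nondecreasing_cvg_mu => //; first exact: bigcupT_measurable.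
  move=> m n mn; apply/subsetPset => t [i /= im ti].
  by exists i => //=; exact: leq_trans im mn.
rewrite UF probability_setT => /(_ [set x | ((1 - q)%:E < x)%E]) [].
  by apply: open_ereal_gt'; rewrite lte_fin ltrBlDr ltrDl.
move=> N _ HN.
exists N => t; apply: contrapT => H.
have disj : dball d t (e / 2) `&` F N = set0.
  apply/seteqP; split => // y [/= ty [i /= iN zy]]; apply: H; exists i => //.
  have := d_tri t y (z i); rewrite (d_sym t y) (d_sym y (z i)).
  by move: ty zy; rewrite /dball/=; lra.
have : (mu (dball d t (e / 2) `|` F N) <= 1)%E.
  by apply: probability_le1; apply: measurableU => //; exact: measurable_dball.
rewrite measureU//; last exact: measurable_dball.
have := HN N (leqnn N); rewrite /= ball_massE.
have finF : mu (F N) \is a fin_num by rewrite fin_num_measure.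
rewrite -(fineK finF) -EFinD lte_fin lee_fin.
by have := hq t; lra.
Qed.

(* Otherwise the masses of all balls are bounded below, although arbitrarily close
   pairs of distinct points produce arbitrarily many disjoint balls. *)
Lemma majorizing_bound_superlinear (K : R) :
  exists2 dl, 0 < dl & forall s t, 0 < d s t -> d s t <= dl ->
    K * d s t <= Jr (d s t / 2).
Proof.
apply: contrapT => H.
have bad dl : 0 < dl -> exists st : T * T,
    [/\ 0 < d st.1 st.2, d st.1 st.2 <= dl & Jr (d st.1 st.2 / 2) < K * d st.1 st.2].
  move=> dl0; apply: contrapT => H'; apply: H; exists dl => // s t st0 stdl.
  by rewrite leNgt; apply/negP => lt; apply: H'; exists (s, t).
(* A bad pair at distance [d] gives [d / 2 * L <= Jr (d / 2) < K * d], so the entropy at radius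
   [d / 2] is at most [2 * K] around every centre, and such radii are arbitrarily small. *)
pose q := expR (- (2 * K) ^+ 2).
have massq t r : 0 < r -> q <= ball_mass t r.
  move=> r0; have [[x y]/= [xy0 xyr lt]] := bad r r0.
  have d20 : 0 < d x y / 2 by rewrite divr_gt0.
  apply: le_trans (le_ball_mass t (_ : d x y / 2 <= r)); last by lra.
  apply: ball_mass_ge => //.
  have := le_trans (entropy_integral_ge t d20) (entropy_integral_le t _).
  move=> /le_lt_trans/(_ lt)/ltW lt2; rewrite -(ler_pM2l d20).
  by have -> : d x y / 2 * (2 * K) = K * d x y by field.
have pack n : exists (x : nat -> T) (e : R), 0 < e /\
    forall i j, (i < n)%N -> (j < n)%N -> i != j -> e <= d (x i) (x j).
  elim: n => [|n [x [e [e0 xe]]]]; first by exists (fun=> point), 1.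
  have e20 : 0 < e / 2 by rewrite divr_gt0.
  have [[s t]/= [st0 ste _]] := bad _ e20.
  suff [y hy] : exists y, forall i, (i < n)%N -> d s t / 2 <= d y (x i).
    exists (fun k => if k == n then y else x k), (d s t / 2).
    split; first by rewrite divr_gt0.
    move=> i j; rewrite !ltnS => iN jN ij.
    case: (eqVneq i n) => [ein|nin]; case: (eqVneq j n) => [ejn|njn].
    - by move: ij; rewrite ein ejn eqxx.
    - by apply: hy; rewrite ltn_neqAle njn.
    - by rewrite (d_sym (x i)); apply: hy; rewrite ltn_neqAle nin.
    - apply: (@le_trans _ _ e); first by lra.
      by apply: xe; rewrite // ltn_neqAle ?nin ?njn.
  (* Otherwise [s] and [t] are both within [d s t / 2] of old points. A common one violates the
     triangle inequality; two distinct ones are closer than [2 * d s t], which is at most [e]. *)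
  apply: contrapT => Hn.
  have close y : exists2 i, (i < n)%N & d y (x i) < d s t / 2.
    apply: contrapT => Hy; apply: Hn; exists y => i iN.
    by rewrite leNgt; apply/negP => lt; apply: Hy; exists i.
  have [i iN si] := close s; have [j jN tj] := close t.
  have := d_tri s (x i) t; rewrite (d_sym (x i) t) => tri1.
  have [ij|ij] := eqVneq i j.
    by move: tri1 si tj; rewrite ij; lra.
  have := d_tri (x i) s (x j); have := d_tri s t (x j); have := xe _ _ iN jN ij.
  by rewrite (d_sym (x i) s); lra.
have q0 : 0 < q by exact: expR_gt0.
have [x [e [e0 xe]]] := pack (Num.truncn q^-1).+1.
(* More than [q^-1] disjoint balls of mass at least [q] would exceed the total mass one. *)
set n := (Num.truncn q^-1).+1 in xe.
have e30 : 0 < e / 3 by rewrite divr_gt0.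
pose B (i : 'I_n) : set (borel_space T) := dball d (x i) (e / 3).
have tB : trivIset setT B.
  apply/trivIsetP => i j _ _ ij; apply/seteqP; split => // y; rewrite /B /dball/= => -[yi yj].
  have := xe i j (ltn_ord i) (ltn_ord j) ij; have := d_tri (x i) y (x j).
  by rewrite (d_sym (x i) y); lra.
have mB i : measurable (B i) by exact: measurable_dball.
have mUB : measurable (\big[setU/set0]_(i < n) B i) by exact: bigsetU_measurable.
have qB i : (q%:E <= mu (B i))%E by rewrite ball_massE lee_fin; exact: massq.
have := probability_le1 mu mUB.
rewrite (measure_semi_additive_ord mu mB tB mUB).
apply/negP; rewrite -ltNge.
apply: (@lt_le_trans _ _ (\sum_(i < n) q%:E)%E); last first.
  by apply: lee_sum => i _; exact: qB.
rewrite sumEFin sumr_const card_ord lte_fin -mulr_natl -ltr_pdivrMr// mul1r.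
exact: truncnS_gt.
Qed.

End majorizing.

(** * Chaining *)

(** Two convexity bounds: a variance is nonnegative, and the exponential lies above its tangent at
    [ln (Y / W)]. *)
Lemma jensen_expR_sqr (R : realType) (K : finType) (P : pred K) (w y : K -> R) (Y : R) :
  (forall k, 0 <= w k) -> 0 < \sum_(k | P k) w k ->
  \sum_(k | P k) w k * expR (y k ^+ 2) <= Y ->
  ((\sum_(k | P k) w k * y k) / (\sum_(k | P k) w k)) ^+ 2
    <= ln (Y / \sum_(k | P k) w k).
Proof.
move=> w0; set W := \sum_(k | P k) w k => W0 hY.
have hW : W <= \sum_(k | P k) w k * expR (y k ^+ 2).
  apply: ler_sum => k _; rewrite ler_peMr//.
  by rewrite -[leLHS]expR0 ler_expR sqr_ge0.
have Y0 : 0 < Y by apply: lt_le_trans W0 (le_trans hW hY).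
have YW0 : 0 < Y / W by rewrite divr_gt0.
set c := _ / W.
have cW : \sum_(k | P k) w k * y k = c * W by rewrite /c divfK// gt_eqF.
have h2 : c ^+ 2 * W <= \sum_(k | P k) w k * y k ^+ 2.
  have : 0 <= \sum_(k | P k) w k * (y k - c) ^+ 2.
    by apply: sumr_ge0 => k _; rewrite mulr_ge0// sqr_ge0.
  have -> : \sum_(k | P k) w k * (y k - c) ^+ 2 =
      \sum_(k | P k) w k * y k ^+ 2 - 2 * c * (\sum_(k | P k) w k * y k) + c ^+ 2 * W.
    rewrite /W !mulr_sumr -sumrB -big_split/=; apply: eq_bigr => k _; ring.
  rewrite cW; nra.
have h3 : \sum_(k | P k) w k * y k ^+ 2 <= W * ln (Y / W).
  have : \sum_(k | P k) w k * (Y / W * (1 + (y k ^+ 2 - ln (Y / W)))) <= Y.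
    apply: le_trans hY; apply: ler_sum => k _; rewrite ler_wpM2l//.
    rewrite -[in leRHS](subrK (ln (Y / W)) (y k ^+ 2)) expRD lnK ?posrE// mulrC.
    by rewrite ler_wpM2r ?(ltW YW0)// expR_ge1Dx.
  have -> : \sum_(k | P k) w k * (Y / W * (1 + (y k ^+ 2 - ln (Y / W)))) =
      Y / W * ((1 - ln (Y / W)) * W + \sum_(k | P k) w k * y k ^+ 2).
    rewrite /W mulr_sumr -big_split mulr_sumr/=; apply: eq_bigr => k _; ring.
  rewrite -ler_pdivlMl//.
  have -> : (Y / W)^-1 * Y = W by field; rewrite !gt_eqF.
  lra.
by rewrite -(ler_pM2r W0); apply: le_trans h2 _; rewrite mulrC.
Qed.

Definition wavg {R : realType} {K : finType} (p x : K -> R) (A : pred K) : R :=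
  (\sum_(i | A i) p i * x i) / \sum_(i | A i) p i.

Lemma wavg_pred1 (R : realType) (K : finType) (p x : K -> R) k : p k != 0 ->
  wavg p x (pred1 k) = x k.
Proof. by move=> pk; rewrite /wavg !big_pred1_eq mulrC mulKf. Qed.

(** Jensen's inequality for the product weights on [A] times [B], applied to [2 / D * (x i - x j)];
    since [e i j <= D], the full double sum dominates the sum that arises. *)
Lemma wavg_dist (R : realType) (K : finType) (p x : K -> R) (e : K -> K -> R)
    (A B : pred K) (D Y : R) :
  (forall i, 0 <= p i) -> 0 < \sum_(i | A i) p i -> 0 < \sum_(i | B i) p i ->
  (forall i j, A i -> B j -> 0 < e i j <= D) ->
  \sum_i \sum_j p i * p j * expR (4 / e i j ^+ 2 * (x i - x j) ^+ 2) <= Y ->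
  `|wavg p x A - wavg p x B| <=
    D / 2 * Num.sqrt (ln (Y / ((\sum_(i | A i) p i) * \sum_(i | B i) p i))).
Proof.
move=> p0 wA0 wB0 eD hY; set wA := \sum_(i | A i) p i in wA0 *.
set wB := \sum_(i | B i) p i in wB0 *.
have [i0 [Ai0 _]] : exists i, A i /\ 0 < p i.
  apply: contrapT => H; move: wA0; apply/negP; rewrite -leNgt.
  apply: sumr_le0 => i Ai; rewrite leNgt; apply/negP => pi.
  by apply: H; exists i.
have [j0 [Bj0 _]] : exists i, B i /\ 0 < p i.
  apply: contrapT => H; move: wB0; apply/negP; rewrite -leNgt.
  apply: sumr_le0 => i Ai; rewrite leNgt; apply/negP => pi.
  by apply: H; exists i.
have D0 : 0 < D by case/andP: (eD _ _ Ai0 Bj0) => a b; exact: lt_le_trans b.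
pose P (k : K * K) := A k.1 && B k.2.
pose w (k : K * K) := p k.1 * p k.2.
pose y (k : K * K) := 2 / D * (x k.1 - x k.2).
have sumP (F : K -> K -> R) :
    \sum_(k | P k) F k.1 k.2 = \sum_(i | A i) \sum_(j | B j) F i j.
  by rewrite pair_big.
have WE : \sum_(k | P k) w k = wA * wB.
  rewrite (sumP (fun i j => p i * p j)) /wA mulr_suml; apply: eq_bigr => i _.
  by rewrite mulr_sumr.
have W0 : 0 < \sum_(k | P k) w k by rewrite WE mulr_gt0.
have SY : \sum_(k | P k) w k * expR (y k ^+ 2) <= Y.
  apply: le_trans hY; rewrite pair_big/= big_mkcond/=; apply: ler_sum => -[i j] _ /=.
  rewrite /P /w /y/=; case: ifPn => [/andP[Ai Bj]|_]; last first.
    by rewrite mulr_ge0 ?expR_ge0// mulr_ge0.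
  rewrite ler_wpM2l ?mulr_ge0// ler_expR exprMn ler_wpM2r ?sqr_ge0//.
  have /andP[e0 eD'] := eD i j Ai Bj.
  rewrite exprMn exprVn (_ : 2 ^+ 2 = 4); last by ring.
  by rewrite ler_wpM2l// lef_pV2 ?posrE ?exprn_gt0// lerXn2r// ?nnegrE ltW.
have := @jensen_expR_sqr R _ P w y Y (fun k => mulr_ge0 (p0 _) (p0 _)) W0 SY.
have -> : (\sum_(k | P k) w k * y k) / (\sum_(k | P k) w k) =
    2 / D * (wavg p x A - wavg p x B).
  rewrite WE (sumP (fun i j => p i * p j * (2 / D * (x i - x j)))).
  have -> : \sum_(i | A i) \sum_(j | B j) p i * p j * (2 / D * (x i - x j)) =
      2 / D * ((\sum_(i | A i) p i * x i) * wB - wA * (\sum_(j | B j) p j * x j)).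
    rewrite /wA /wB !mulr_suml -sumrB mulr_sumr; apply: eq_bigr => i _.
    rewrite !mulr_sumr -sumrB mulr_sumr; apply: eq_bigr => j _; ring.
  rewrite /wavg -/wA -/wB; field.
  by rewrite !gt_eqF.
rewrite WE; set q := ln _; move=> hq.
have Dn : D / 2 * (2 / D) = 1 by field; rewrite gt_eqF.
have -> : `|wavg p x A - wavg p x B| =
    D / 2 * `|2 / D * (wavg p x A - wavg p x B)|.
  rewrite normrM (@ger0_norm _ (2 / D)); last by rewrite divr_ge0// ltW.
  by rewrite mulrA Dn mul1r.
rewrite ler_wpM2l//; first by rewrite divr_ge0// ltW.
by rewrite -sqrtr_sqr ler_wsqrtr.
Qed.

(** Subadditivity of the square root. The factor 4 collects the two halves lost in [m1 / 2] and
    [m2 / 2]. *)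
Lemma sqrt_ln_mass (R : realType) (Y w1 w2 m1 m2 : R) :
  1 <= Y -> 0 < m1 <= 1 -> 0 < m2 <= 1 -> m1 / 2 <= w1 -> m2 / 2 <= w2 ->
  Num.sqrt (ln (Y / (w1 * w2))) <=
  Num.sqrt (ln (4 * Y)) + Num.sqrt (- ln m1) + Num.sqrt (- ln m2).
Proof.
move=> Y1 /andP[m10 m11] /andP[m20 m21] w1m w2m.
have Y0 : 0 < Y by exact: lt_le_trans Y1.
have w10 : 0 < w1 by apply: lt_le_trans w1m; rewrite divr_gt0.
have w20 : 0 < w2 by apply: lt_le_trans w2m; rewrite divr_gt0.
have Y40 : 0 <= ln (4 * Y) by rewrite ln_ge0//; lra.
have l1 : 0 <= - ln m1 by rewrite oppr_ge0 ln_le0.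
have l2 : 0 <= - ln m2 by rewrite oppr_ge0 ln_le0.
have h : ln (Y / (w1 * w2)) <= ln (4 * Y) + - ln m1 + - ln m2.
  rewrite -!lnV ?posrE// -!lnM ?posrE ?mulr_gt0 ?invr_gt0// ?mulr_gt0//.
  rewrite ler_ln ?posrE ?divr_gt0 ?mulr_gt0 ?invr_gt0//.
  rewrite ler_pdivrMr ?mulr_gt0//.
  have -> : 4 * Y / m1 / m2 * (w1 * w2) = Y * ((2 * w1 / m1) * (2 * w2 / m2)).
    by field; rewrite !gt_eqF.
  apply: ler_peMr; first exact: ltW.
  have a1 : 1 <= 2 * w1 / m1 by rewrite ler_pdivlMr//; lra.
  have a2 : 1 <= 2 * w2 / m2 by rewrite ler_pdivlMr//; lra.
  by rewrite -[leLHS]mulr1 ler_pM.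
apply: le_trans (ler_wsqrtr h) _.
set a := Num.sqrt (ln _); set b := Num.sqrt (- ln m1); set c := Num.sqrt (- ln m2).
have a0 : 0 <= a by exact: sqrtr_ge0.
have b0 : 0 <= b by exact: sqrtr_ge0.
have c0 : 0 <= c by exact: sqrtr_ge0.
rewrite -[leRHS]ger0_norm ?addr_ge0// -sqrtr_sqr ler_wsqrtr//.
have -> : ln (4 * Y) = a ^+ 2 by rewrite sqr_sqrtr.
have -> : - ln m1 = b ^+ 2 by rewrite sqr_sqrtr.
have -> : - ln m2 = c ^+ 2 by rewrite sqr_sqrtr.
have : 0 <= a * b + a * c + b * c by rewrite !addr_ge0 ?mulr_ge0.
have -> : (a + b + c) ^+ 2 = a ^+ 2 + b ^+ 2 + c ^+ 2 + 2 * (a * b + a * c + b * c) by ring.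
lra.
Qed.

(** * Chaining over a finite weighted net *)

Section finite_chaining.
Context (R : realType) (T : pseudoPMetricType R) (d : T -> T -> R)
  (mu : probability (borel_space T) R).
Hypothesis pm : is_pseudometric d.
Hypothesis ib : induces_balls d.
Hypothesis Jcvg : majorizing_integral d mu delta @[delta --> 0^'+] --> 0%E.
Context (N : nat) (z : 'I_N -> T) (p x : 'I_N -> R) (eps Y : R).
Hypothesis p_gt0 : forall i, 0 < p i.
Hypothesis p_le1 : forall i, p i <= 1.
Hypothesis eps_gt0 : 0 < eps.
Hypothesis Y_ge1 : 1 <= Y.
Hypothesis p_mass : forall t r, 0 < r ->
  ball_mass d mu t r / 2 <= \sum_(i | d t (z i) <= r + eps) p i.
Hypothesis Y_bound : \sum_i \sum_j p i * p j *
  expR (4 / (d (z i) (z j) + eps) ^+ 2 * (x i - x j) ^+ 2) <= Y.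

Let d_ge0 s t : 0 <= d s t. Proof. by case: pm. Qed.
Let d_refl t : d t t = 0. Proof. by case: pm. Qed.
Let d_sym s t : d s t = d t s. Proof. by case: pm. Qed.
Let d_tri s t u : d s u <= d s t + d t u. Proof. by case: pm. Qed.

Local Notation L := (ball_entropy d mu).
Local Notation Ir := (entropy_integral d mu).
Let H := Num.sqrt (ln (4 * Y)).
Let M t r := wavg p x (fun i => d t (z i) <= r + eps).

Let mass01 t r : 0 < r -> 0 < ball_mass d mu t r <= 1.
Proof. by move=> r0; rewrite ball_mass_gt0// ball_mass_le1. Qed.

Let p_ge0 i : 0 <= p i. Proof. exact: ltW. Qed.

Let wavg_dist_le (A B : pred 'I_N) (D m1 m2 : R) :
  0 < m1 <= 1 -> 0 < m2 <= 1 ->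
  m1 / 2 <= \sum_(i | A i) p i -> m2 / 2 <= \sum_(i | B i) p i ->
  0 <= D -> (forall i j, A i -> B j -> d (z i) (z j) + eps <= 2 * D) ->
  `|wavg p x A - wavg p x B| <= D * (H + Num.sqrt (- ln m1) + Num.sqrt (- ln m2)).
Proof.
move=> m1b m2b Am Bm D0 AB.
have wA : 0 < \sum_(i | A i) p i.
  by apply: lt_le_trans Am; case/andP: m1b => ? _; rewrite divr_gt0.
have wB : 0 < \sum_(i | B i) p i.
  by apply: lt_le_trans Bm; case/andP: m2b => ? _; rewrite divr_gt0.
(* [wavg_dist] needs positive distances even when sample points coincide; the summand [eps] provides
   this. *)
have := @wavg_dist R _ p x (fun i j => d (z i) (z j) + eps) A B (2 * D) Y p_ge0 wA wB.
move=> /(_ _ Y_bound) h; apply: le_trans (h _) _.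
  by move=> i j Ai Bj; rewrite ltr_wpDl//= AB.
have -> : 2 * D / 2 = D by field.
by rewrite ler_wpM2l// sqrt_ln_mass.
Qed.

(* A potential: each step of the chain is bounded by its decrement, and the term
   [- 3 * r * L t r] pays for the link between the two chains. *)
Let Phi t r := 3 * r * H + 9 * Ir t r - 3 * r * L t r.

Let step t r : 0 < r -> 2 * eps <= r / 2 ->
  `|M t r - M t (r / 2)| <= Phi t r - Phi t (r / 2).
Proof.
move=> r0 re; have r20 : 0 < r / 2 by rewrite divr_gt0.
(* Points of the two enlarged balls satisfy [d (z i) (z j) + eps <= 3 / 2 * r + 3 * eps], which is
   below [3 * r] as [eps <= r / 4]. *)
have h : `|M t r - M t (r / 2)| <= 3 / 2 * r * (H + L t r + L t (r / 2)).
  apply: wavg_dist_le; try exact: mass01; try exact: p_mass.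
    by rewrite mulr_ge0// ltW.
  move=> i j ti tj; have := d_tri (z i) t (z j); rewrite (d_sym (z i) t).
  by move: ti tj; have := eps_gt0; lra.
apply: le_trans h _; rewrite /Phi.
have := entropy_integral_halve pm ib Jcvg t r0.
set I1 := Ir t r; set I2 := Ir t _; set L1 := L t r; set L2 := L t _.
have -> : r / 2 * L1 = (r * L1) / 2 by ring.
have -> : 3 / 2 * r * (H + L1 + L2) = 3 / 2 * (r * H) + 3 / 2 * (r * L1) + 3 / 2 * (r * L2).
  ring.
have -> : 3 * r * H + 9 * I1 - 3 * r * L1 - (3 * (r / 2) * H + 9 * I2 - 3 * (r / 2) * L2)
  = 3 / 2 * (r * H) + 9 * I1 - 3 * (r * L1) - 9 * I2 + 3 / 2 * (r * L2) by field.
lra.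
Qed.

Let chain t r m : 0 < r -> 2 * eps <= r / 2 ^+ m ->
  `|M t r - M t (r / 2 ^+ m)| <= Phi t r - Phi t (r / 2 ^+ m).
Proof.
move=> r0; elim: m => [|m IH] rm; first by rewrite expr0 divr1 !subrr normr0.
have E : r / 2 ^+ m.+1 = r / 2 ^+ m / 2 by rewrite exprS; field; rewrite expf_neq0.
rewrite E in rm *; have rm0 : 0 < r / 2 ^+ m by rewrite divr_gt0// exprn_gt0.
have := IH (le_trans rm (_ : r / 2 ^+ m / 2 <= r / 2 ^+ m)).
move=> /(_ ltac:(lra)) h1; have h2 := step t rm0 rm.
set a := M t r in h1 *; set b := M t (r / 2 ^+ m) in h1 h2.
have -> : a - M t (r / 2 ^+ m / 2) = (a - b) + (b - M t (r / 2 ^+ m / 2)) by ring.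
by apply: le_trans (ler_normD _ _) _; lra.
Qed.

(** The value at a sample point is the average over a singleton of weight [p i], so the estimate for
    averages applies to it. *)
Let last_link i r : 0 < r -> 2 * eps <= r ->
  `|M (z i) r - x i| <= r * (H + L (z i) r + Num.sqrt (- ln (p i))).
Proof.
move=> r0 re; rewrite -[in X in `|X|](@wavg_pred1 _ _ p x i) ?gt_eqF//.
apply: wavg_dist_le.
- exact: mass01.
- by rewrite p_gt0 p_le1.
- exact: p_mass.
- by rewrite big_pred1_eq; have := p_gt0 i; lra.
- exact: ltW.
- by move=> k j ik /eqP ->; rewrite (d_sym (z k)); lra.
Qed.

Let endpoint i r m : 0 < r -> 2 * eps <= r / 2 ^+ m ->
  `|M (z i) r - x i| <= Phi (z i) r +
    r / 2 ^+ m * (H + L (z i) (r / 2 ^+ m) + Num.sqrt (- ln (p i))).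
Proof.
move=> r0 rm; have rm0 : 0 < r / 2 ^+ m by rewrite divr_gt0// exprn_gt0.
have h1 := chain (z i) r0 rm; have h2 := last_link i rm0 rm.
have Phi0 : 0 <= Phi (z i) (r / 2 ^+ m).
  rewrite /Phi; have := entropy_integral_ge pm ib Jcvg (z i) rm0.
  have H0 : 0 <= H by exact: sqrtr_ge0.
  have : 0 <= r / 2 ^+ m * H by rewrite mulr_ge0// ltW.
  have := ball_entropy_ge0 d mu (z i) (r / 2 ^+ m).
  set rr := r / _; set LL := L _ _; set II := Ir _ _ => LL0 rH rL.
  have rL0 : 0 <= rr * LL by rewrite mulr_ge0// ltW.
  have -> : 3 * rr * H + 9 * II - 3 * rr * LL =
    3 * (rr * H) + 9 * (II - rr * LL) + 6 * (rr * LL) by ring.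
  by apply: addr_ge0; [apply: addr_ge0|]; apply: mulr_ge0 => //; rewrite subr_ge0.
set b := M (z i) (r / 2 ^+ m) in h1 h2.
have -> : M (z i) r - x i = (M (z i) r - b) + (b - x i) by ring.
apply: le_trans (ler_normD _ _) _; lra.
Qed.

(** Two chains of cost [Phi] are joined by a link between balls of radius [r]. The entropy terms of
    the link cancel against those in the potentials, and three terms [3 * r * H] add up to
    [9 * r * H]. *)
Lemma finite_chaining i j r m : 0 < r -> 2 * eps <= r / 2 ^+ m ->
  d (z i) (z j) <= 2 * r ->
  let c k := r / 2 ^+ m *
    (H + L (z k) (r / 2 ^+ m) + Num.sqrt (- ln (p k))) in
  `|x i - x j| <= 9 * (Ir (z i) r + Ir (z j) r) + 9 * r * H + c i + c j.
Proof.
move=> r0 rm ij /=.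
have hi := endpoint i r0 rm; have hj := endpoint j r0 rm.
have rr : r / 2 ^+ m <= r.
  rewrite ler_pdivrMr ?exprn_gt0//; apply: ler_peMr; first exact: ltW.
  by rewrite exprn_ege1// ler1n.
have h : `|M (z i) r - M (z j) r| <= 3 * r * (H + L (z i) r + L (z j) r).
  apply: wavg_dist_le; try exact: mass01; try exact: p_mass.
    by rewrite mulr_ge0// ltW.
  move=> k l ik jl; have := d_tri (z k) (z i) (z l); rewrite (d_sym (z k) (z i)).
  by have := d_tri (z i) (z j) (z l); move: ik jl; have := eps_gt0; lra.
have -> : x i - x j = (M (z i) r - M (z j) r) + (M (z j) r - x j) - (M (z i) r - x i).
  by ring.
apply: le_trans (ler_normB _ _) _; apply: le_trans (lerD (ler_normD _ _) (lexx _)) _.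
move: hi hj h; rewrite /Phi.
set ci := r / 2 ^+ m * (_ + L (z i) _ + _); set cj := r / 2 ^+ m * (_ + L (z j) _ + _).
rewrite !mulrDr; lra.
Qed.

End finite_chaining.

(** * Replacement of [mu] by weights on finite nets *)

Section discretization.
Context (R : realType) (T : pseudoPMetricType R) (d : T -> T -> R)
  (mu : probability (borel_space T) R).
Hypothesis pm : is_pseudometric d.
Hypothesis ib : induces_balls d.
Hypothesis Jcvg : majorizing_integral d mu delta @[delta --> 0^'+] --> 0%E.
Context (z : nat -> T).
Hypothesis z_dense : forall t e, 0 < e -> exists i, d t (z i) < e.

Lemma sum_geometric_half (N : nat) : \sum_(i < N) (2^-1 : R) ^+ i.+1 <= 1.
Proof.
suff -> : \sum_(i < N) (2^-1 : R) ^+ i.+1 = 1 - 2^-1 ^+ N.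
  by rewrite gerBl exprn_ge0.
elim: N => [|N IH]; first by rewrite big_ord0 expr0 subrr.
by rewrite big_ord_recr/= IH exprS; field.
Qed.

(* The geometric part of the weights gives every sample point a positive mass, so that
   chains may end at the point itself. *)
Lemma exists_discrete_weights (n : nat) (e : R) : 0 < e ->
  exists (N : nat) (p : nat -> R),
    [/\ (n <= N)%N, (forall i, 2^-1 ^+ i.+2 <= p i <= 1), \sum_(i < N) p i <= 1 &
     forall t r, 0 < r -> ball_mass d mu t r / 2 <=
       \sum_(i < N | d t (z i) <= r + e) p i].
Proof.
move=> e0; have [N0 HN0] := majorizing_finite_net pm ib Jcvg z_dense e0.
have [_ _ d_sym d_tri] := pm.
pose N := maxn N0 n.
(* Disjoint cells: a point belongs to the first [z i] at distance less than [e]. *)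
pose C (i : nat) : set (borel_space T) :=
  [set t | d (z i) t < e] `\` \bigcup_(j in `I_i) [set t | d (z j) t < e].
have mC i : measurable (C i).
  apply: measurableD; first exact: measurable_dist_lt.
  by apply: bigcup_measurable => j _; exact: measurable_dist_lt.
have CE i : mu (C i) = (fine (mu (C i)))%:E by rewrite fineK// fin_num_measure.
have sumC (A : pred 'I_N) :
    ((\sum_(i < N | A i) fine (mu (C i)))%:E =
     mu (\big[setU/set0]_(i < N) if A i then C i else set0))%E.
  have mF i : measurable (if A i then C i else set0) by case: ifP.
  rewrite (@measure_semi_additive_ord _ _ _ mu N (fun i => if A i then C i else set0))//.
  - rewrite -sumEFin big_mkcond/=; apply: eq_bigr => i _.
    by case: ifP => _; rewrite ?measure0// -CE.
  - apply/trivIsetP => i j _ _ ij; wlog lij : i j ij / (i < j)%N.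
      move=> W; move: (ij); rewrite neq_ltn => /orP[/W->//|ji].
      by rewrite setIC; apply: W; rewrite // eq_sym.
    apply/seteqP; split => // t /=; case: ifP => _; case: ifP => _; try by case.
    by rewrite /C/= => -[[h1 _] [_ h2]]; apply: h2; exists i.
  - by apply: bigsetU_measurable => i _; case: ifP.
pose c i := fine (mu (C i)).
have c0 i : 0 <= c i by rewrite /c fine_ge0.
have c1 i : c i <= 1 by rewrite -lee_fin -CE probability_le1.
have g0 (i : nat) : 0 < (2^-1 : R) ^+ i.+1 by rewrite exprn_gt0// invr_gt0.
(* Averaging the cell masses with the geometric weights keeps the total at most one and costs the
   factor 2 in the comparison with [ball_mass]. *)
exists N, (fun i => (c i + 2^-1 ^+ i.+1) / 2); split.
- exact: leq_maxr.
- move=> i; apply/andP; split.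
    by rewrite exprSr ler_wpM2r ?invr_ge0// lerDr.
  have : (2^-1 : R) ^+ i.+1 <= 1 by rewrite exprn_ile1 ?invr_ge0// invf_le1// ler1n.
  by have := c1 i; lra.
- rewrite -mulr_suml big_split/=; have := sum_geometric_half N.
  suff : \sum_(i < N) c i <= 1 by lra.
  have := sumC predT => /= E; rewrite -lee_fin E probability_le1//.
  by apply: bigsetU_measurable => i _; exact: mC.
- move=> t r r0; rewrite -mulr_suml ler_pM2r ?invr_gt0//.
  apply: (@le_trans _ _ (\sum_(i < N | d t (z i) <= r + e) c i)); last first.
    by apply: ler_sum => i _; rewrite lerDl ltW.
  rewrite -lee_fin sumC -ball_massE//; apply: le_measure; rewrite ?inE.
  + exact: measurable_dball.
  + by apply: bigsetU_measurable => i _; case: ifP.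
  move=> s /= st.
  have ex : exists i, (i < N)%N && (d (z i) s < e).
    have [i iN si] := HN0 s; exists i; rewrite d_sym si andbT.
    by rewrite (leq_trans iN)// leq_maxl.
  case: (ex_minnP ex) => i /andP[iN si] imin.
  rewrite -bigcup_seq; exists (Ordinal iN); first by rewrite /= mem_index_enum.
  have tzi : d t (z i) <= r + e.
    by have := d_tri t s (z i); rewrite (d_sym t s) (d_sym s (z i));
      move: st; rewrite /dball/=; lra.
  rewrite tzi; split => // -[j /= ji sj].
  by have := imin j; rewrite (ltn_trans ji iN) sj leqNgt ji => /(_ isT).
Qed.

End discretization.

(** * The modulus along a dense sequence *)

Section sample_modulus.
Context (R : realType) (T : pseudoPMetricType R) (d : T -> T -> R)
  (mu : probability (borel_space T) R).
Hypothesis pm : is_pseudometric d.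
Hypothesis ib : induces_balls d.
Hypothesis Jcvg : majorizing_integral d mu delta @[delta --> 0^'+] --> 0%E.
Context (z : nat -> T).
Local Notation Jr := (majorizing_bound d mu).

Definition weighted_exp_sum (x p : nat -> R) (N : nat) (e : R) : R :=
  \sum_(i < N) \sum_(j < N)
    p i * p j * expR (4 / (d (z i) (z j) + e) ^+ 2 * (x i - x j) ^+ 2).

(** The lower bound on the weights does not depend on [n], so the last links become negligible for
    long chains. The chain length is fixed first; then [n] is taken large, among the indices with
    bounded sum, so that [e n] is small. *)
Lemma chaining_limit (x : nat -> R) (e : nat -> R) (N : nat -> nat)
    (p : nat -> nat -> R) (Y : R) :
  (forall n, 0 < e n) -> e @ \oo --> 0 -> (forall n, (n <= N n)%N) ->
  (forall n i, 2^-1 ^+ i.+2 <= p n i <= 1) ->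
  (forall n t r, 0 < r -> ball_mass d mu t r / 2 <=
     \sum_(i < N n | d t (z i) <= r + e n) p n i) ->
  1 <= Y ->
  (forall m, exists2 n, (m <= n)%N & weighted_exp_sum x (p n) (N n) (e n) <= Y) ->
  forall i j, `|x i - x j| <=
    18 * Jr (d (z i) (z j) / 2) + 9 / 2 * Num.sqrt (ln (4 * Y)) * d (z i) (z j).
Proof.
move=> e0 ecvg nN pb pmass Y1 freq i j.
have [d_ge0 _ _ _] := pm.
set H := Num.sqrt (ln (4 * Y)).
have H0 : 0 <= H by exact: sqrtr_ge0.
pose q i := Num.sqrt (- ln ((2^-1 : R) ^+ i.+2)).
have key r : 0 < r -> d (z i) (z j) <= 2 * r -> `|x i - x j| <= 18 * Jr r + 9 * r * H.
  move=> r0 ijr; apply/ler_addgt0Pr => s s0.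
  have [dl dl0 Jdl] : exists2 dl, 0 < dl & Jr dl <= s / 4.
    by apply: majorizing_bound_small => //; rewrite divr_gt0.
  (* Half of the error [s] pays for the [H] and weight terms of both last links, and a quarter for
     each of the two entropy terms. *)
  pose C := 2 * H + q i + q j + 1.
  have C0 : 0 < C by rewrite ltr_wpDl// !addr_ge0 ?sqrtr_ge0// mulr_ge0.
  have [m rmdl rmC] : exists2 m, r / 2 ^+ m <= dl & r / 2 ^+ m * C <= s / 2.
    pose tau := Num.min dl (s / 2 / C).
    have tau0 : 0 < tau by rewrite lt_min dl0 !divr_gt0.
    suff [m hm] : exists m, r / 2 ^+ m <= tau.
      move: hm; rewrite /tau le_min => /andP[h1 h2]; exists m => //.
      by rewrite -ler_pdivlMr.
    exists (Num.truncn (r / tau)).+1; rewrite ler_pdivrMr ?exprn_gt0//.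
    rewrite -ler_pdivrMl// mulrC; apply: le_trans (ltW (truncnS_gt _)) _.
    by rewrite -natrX ler_nat ltnW// ltn_expl.
  set rho := r / 2 ^+ m in rmdl rmC.
  have rho0 : 0 < rho by rewrite divr_gt0// exprn_gt0.
  have [n0 _ Hn0] : \forall n \near \oo, 2 * e n <= rho.
    have : \forall n \near \oo, e n < rho / 2.
      by apply: (cvgr_lt 0) => //; rewrite divr_gt0.
    by apply: filterS => n; lra.
  have [n hn hY] := freq (maxn n0 (maxn i j).+1).
  have n0n : (n0 <= n)%N by rewrite (leq_trans _ hn)// leq_maxl.
  have ijn : (maxn i j < N n)%N.
    by rewrite (leq_trans _ (nN n))// (leq_trans _ hn)// leq_maxr.
  have iN : (i < N n)%N by rewrite (leq_ltn_trans _ ijn)// leq_maxl.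
  have jN : (j < N n)%N by rewrite (leq_ltn_trans _ ijn)// leq_maxr.
  have p0 k : 0 < p n k.
    by case/andP: (pb n k) => h _; apply: lt_le_trans h; rewrite exprn_gt0// invr_gt0.
  have p1 k : p n k <= 1 by case/andP: (pb n k).
  have := @finite_chaining R T d mu pm ib Jcvg (N n) (fun k => z k) (fun k => p n k)
    (fun k => x k) (e n) Y (fun k => p0 k) (fun k => p1 k) (e0 n) Y1 (pmass n) hY
    (Ordinal iN) (Ordinal jN) r m r0 (Hn0 n n0n) ijr.
  rewrite /= -/H -/rho => fc; apply: le_trans fc _.
  have Cp k : Num.sqrt (- ln (p n k)) <= q k.
    by rewrite ler_wsqrtr// lerN2 ler_ln ?posrE//; case/andP: (pb n k).
  have rL k : rho * ball_entropy d mu (z k) rho <= s / 4.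
    apply: le_trans (entropy_integral_ge pm ib Jcvg (z k) rho0) _.
    apply: le_trans (entropy_integral_le pm ib Jcvg _ _) _.
    by apply: le_trans Jdl; apply: le_majorizing_bound.
  have rP k : rho * Num.sqrt (- ln (p n k)) <= rho * q k by rewrite ler_wpM2l// ltW.
  have := entropy_integral_le pm ib Jcvg (z i) r.
  have := entropy_integral_le pm ib Jcvg (z j) r.
  have := rL i; have := rL j; have := rP i; have := rP j.
  move: rmC rho0; rewrite /C; move: (ball_entropy _ _ (z i) _) (ball_entropy _ _ (z j) _).
  move: (entropy_integral _ _ (z i) _) (entropy_integral _ _ (z j) _) (Jr r).
  move: (Num.sqrt (- ln (p n i))) (Num.sqrt (- ln (p n j))) (q i) (q j) => a b c f g k l o t.
  rewrite !mulrDr !mulr1 (mulrCA rho 2); move: {C C0}H H0 => H' H0'.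
  clear -s0; lra.
(* At distance zero [key] holds for every positive [r], which is then made small; otherwise [r] is
   half the distance. *)
have [d0|d0] := eqVneq (d (z i) (z j)) 0.
  rewrite d0 mul0r majorizing_bound0// !mulr0 addr0.
  apply/ler_addgt0Pr => s s0; rewrite add0r.
  have [dl dl0 Jdl] : exists2 dl, 0 < dl & Jr dl <= s / 36.
    by apply: majorizing_bound_small => //; rewrite divr_gt0.
  pose r := Num.min dl (s / (18 * (H + 1))).
  have H1 : 0 < H + 1 by rewrite ltr_wpDl.
  have r0 : 0 < r by rewrite lt_min dl0/= divr_gt0// mulr_gt0.
  have := key r r0; rewrite d0 => /(_ (mulr_ge0 _ (ltW r0)))/le_trans; apply => //.
  have h1 : Jr r <= s / 36.
    by apply: le_trans Jdl; apply: le_majorizing_bound => //; rewrite ge_min lexx.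
  have : r * (18 * (H + 1)) <= s.
    by rewrite -ler_pdivlMr ?mulr_gt0// ge_min lexx orbT.
  have -> : 9 * r * H = (r * (18 * (H + 1))) / 2 - 9 * r by field.
  lra.
have dij : 0 < d (z i) (z j) by rewrite lt_neqAle eq_sym d0 d_ge0.
have := key (d (z i) (z j) / 2); rewrite divr_gt0// => /(_ isT).
have -> : 2 * (d (z i) (z j) / 2) = d (z i) (z j) by field.
move=> /(_ (lexx _))/le_trans; apply.
by rewrite lerD2l le_eqVlt; apply/orP; left; apply/eqP; field.
Qed.

Hypothesis z_dense : forall t e, 0 < e -> exists i, d t (z i) < e.
Context (dO : measure_display) (Omega : measurableType dO)
  (P : probability Omega R) (Gamma : T -> T -> R) (theta : T -> {RV P >-> R}).
Hypothesis perm : permanental_process Gamma theta.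
Hypothesis dom : forall x y, permanental_dist Gamma x y <= d x y.

(** The factor in [permanental_dist] is fitted to this: its square is 32/3, and
    [32 / 3 * v <= (d s t + e) ^+ 2] is the condition [8 * lam * v <= 3] for
    [lam = 4 / (d s t + e) ^+ 2]. *)
Lemma integral_sqrt_increment s t (e : R) : 0 < e ->
  (\int[P]_w (expR (4 / (d s t + e) ^+ 2 *
     (Num.sqrt (theta s w) - Num.sqrt (theta t w)) ^+ 2))%:E <= 4%:E)%E.
Proof.
move=> e0; have [d_ge0 _ _ _] := pm.
have de : 0 < d s t + e by rewrite ltr_wpDl.
have de2 : 0 < (d s t + e) ^+ 2 by rewrite exprn_gt0.
apply: (permanental_sqrt_increment perm); first by rewrite divr_ge0// sqr_ge0.
set v := _ - _.
rewrite (_ : 8 * (4 / (d s t + e) ^+ 2) * v = 32 * v / (d s t + e) ^+ 2); last first.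
  by field; rewrite gt_eqF.
rewrite ler_pdivrMr//.
have [v0|v0] := leP v 0.
  by apply: (@le_trans _ _ 0); [lra|rewrite mulr_ge0// sqr_ge0].
have := dom s t; rewrite /permanental_dist -/v => h.
have : (4 * Num.sqrt (2 / 3) * Num.sqrt v) ^+ 2 <= (d s t + e) ^+ 2.
  apply: lerXn2r; rewrite ?nnegrE ?mulr_ge0 ?sqrtr_ge0//; first exact: ltW.
  by apply: le_trans h _; rewrite lerDl ltW.
rewrite !exprMn !sqr_sqrtr ?(ltW v0)//.
by have -> : 4 ^+ 2 * (2 / 3) * v = 32 / 3 * v; [field|lra].
Qed.

Lemma ae_sample_modulus :
  {ae P, forall w, exists K : R, forall i j,
    `|Num.sqrt (theta (z i) w) - Num.sqrt (theta (z j) w)| <=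
      18 * Jr (d (z i) (z j) / 2) + K * d (z i) (z j)}.
Proof.
have [d_ge0 _ _ _] := pm.
pose e (n : nat) : R := n.+1%:R^-1.
have e0 n : 0 < e n by rewrite invr_gt0.
have /choice[Np HNp] : forall n, exists Np : nat * (nat -> R),
    [/\ (n <= Np.1)%N, (forall i, 2^-1 ^+ i.+2 <= Np.2 i <= 1), \sum_(i < Np.1) Np.2 i <= 1 &
     forall t r, 0 < r -> ball_mass d mu t r / 2 <=
       \sum_(i < Np.1 | d t (z i) <= r + e n) Np.2 i].
  move=> n; have [N [p h]] := exists_discrete_weights pm ib Jcvg z_dense n (e0 n).
  by exists (N, p).
pose N n := (Np n).1; pose p n := (Np n).2.
pose X w i := Num.sqrt (theta (z i) w).
pose Y n w := weighted_exp_sum (X w) (p n) (N n) (e n).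
have p0 n i : 0 <= p n i.
  have [_ pb _ _] := HNp n; case/andP: (pb i) => h _; apply: le_trans h.
  by rewrite exprn_ge0// invr_ge0.
have mX i : measurable_fun setT (X ^~ i).
  apply: measurableT_comp => //.
  by apply: continuous_measurable_fun; exact: sqrt_continuous.
have mE n i j : measurable_fun setT (fun w =>
    (expR (4 / (d (z i) (z j) + e n) ^+ 2 * (X w i - X w j) ^+ 2))%:E).
  apply/measurable_EFinP; apply: measurableT_comp => //; apply: measurable_funM => //.
  by apply: measurable_funX; exact: measurable_funB.
have YE n w : (Y n w)%:E = (\sum_(i < N n) \sum_(j < N n)
    ((p n i * p n j)%:E * (expR (4 / (d (z i) (z j) + e n) ^+ 2 * (X w i - X w j) ^+ 2))%:E))%E.
  rewrite /Y /weighted_exp_sum -sumEFin; apply: eq_bigr => i _.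
  by rewrite -sumEFin; apply: eq_bigr => j _; rewrite EFinM.
have pE0 n i j w : (0 <= (p n i * p n j)%:E *
    (expR (4 / (d (z i) (z j) + e n) ^+ 2 * (X w i - X w j) ^+ 2))%:E)%E.
  by rewrite -EFinM lee_fin mulr_ge0 ?expR_ge0// mulr_ge0.
have mpE n i j : measurable_fun setT (fun w => (p n i * p n j)%:E *
    (expR (4 / (d (z i) (z j) + e n) ^+ 2 * (X w i - X w j) ^+ 2))%:E)%E.
  exact: measurable_funeM.
have mY n : measurable_fun setT (fun w => (Y n w)%:E).
  under eq_fun do rewrite YE.
  by apply: emeasurable_sum => i; exact: emeasurable_sum.
have Y0 n w : (0 <= (Y n w)%:E)%E.
  by rewrite YE; apply: sume_ge0 => i _; exact: sume_ge0.
(* Each exponential has mean at most 4, and the weights sum to at most one. *)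
have IY n : (\int[P]_w (Y n w)%:E <= 4%:E)%E.
  under eq_integral do rewrite YE.
  rewrite ge0_integral_sum//; last 2 first.
  - by move=> i; exact: emeasurable_sum.
  - by move=> i w _; exact: sume_ge0.
  apply: (@le_trans _ _ (\sum_(i < N n) \sum_(j < N n) (p n i * p n j * 4)%:E)%E).
    apply: lee_sum => i _; rewrite ge0_integral_sum//.
    apply: lee_sum => j _; rewrite ge0_integralZl//; last first.
      by rewrite lee_fin mulr_ge0.
    rewrite (EFinM (p n i * p n j) 4) lee_wpmul2l ?lee_fin ?mulr_ge0//.
    exact: integral_sqrt_increment.
  under eq_bigr do rewrite sumEFin.
  rewrite sumEFin lee_fin.
  have -> : \sum_(i < N n) \sum_(j < N n) p n i * p n j * 4 =
      4 * ((\sum_(i < N n) p n i) * (\sum_(i < N n) p n i)).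
    rewrite mulr_suml mulr_sumr; apply: eq_bigr => i _.
    by rewrite !mulr_sumr; apply: eq_bigr => j _; ring.
  have [_ _ p1 _] := HNp n.
  have S0 : 0 <= \sum_(i < N n) p n i by apply: sumr_ge0.
  by rewrite -[leRHS]mulr1 ler_wpM2l// -[leRHS]mulr1 ler_pM.
pose F w := limn_einf (fun n => (Y n w)%:E).
have mF : measurable_fun setT F 
  by apply: measurableT_comp => //; apply: measurable_fun_limn_esup => n; exact: measurableT_comp.
have F0 w : (0 <= F w)%E.
  rewrite /F limn_einf_lim; apply: lime_ge; first exact: is_cvg_einfs.
  by apply: nearW => n; apply: le_ereal_inf_tmp => _ [m /= _ <-].
have IF : (\int[P]_w F w < +oo)%E.
  apply: (@le_lt_trans _ _ 4%:E); last exact: ltry.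
  apply: le_trans (fatou P measurableT mY (fun n w _ => Y0 n w)) _.
  rewrite limn_einf_lim; apply: lime_le; first exact: is_cvg_einfs.
  apply: nearW => n; apply: le_trans (IY n).
  by apply: ereal_inf_lbound; exists n => /=.
have Fint : P.-integrable setT F.
  apply/integrableP; split => //.
  by under eq_integral do rewrite gee0_abs//.
have := integrable_ae measurableT Fint.
apply: filterS => w /(_ I) Fw.
(* If the sums exceeded [fine (F w) + 1] from some index on, so would their lower limit, which is
   [F w]. *)
have [M HM] : exists M : R, forall m, exists2 n, (m <= n)%N & Y n w <= M.
  pose M := fine (F w) + 1; exists M => m; apply: contrapT => Hm.
  have : (M%:E <= F w)%E.
    rewrite /F limn_einf_lim; apply: lime_ge; first exact: is_cvg_einfs.
    exists m => // k /= mk; apply: le_ereal_inf_tmp => _ [l /= kl <-].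
    rewrite lee_fin leNgt; apply/negP => /ltW lt; apply: Hm; exists l; last exact: lt.
    exact: leq_trans kl.
  by rewrite /M; move: Fw; case: (F w) => // f _; rewrite lee_fin/=; lra.
pose Y1 := Num.max 1 M.
exists (9 / 2 * Num.sqrt (ln (4 * Y1))) => i j.
apply: (@chaining_limit (X w) e N p Y1) => //.
- exact: cvg_harmonic.
- by move=> n; have [] := HNp n.
- by move=> n; have [] := HNp n.
- by move=> n; have [] := HNp n.
- by rewrite le_max lexx.
- move=> m; have [n mn Yn] := HM m; exists n => //.
  by rewrite le_max Yn orbT.
Qed.

End sample_modulus.

(** * The continuous version *)

Section modification.
Context (R : realType) (T : pseudoPMetricType R) (d : T -> T -> R)
  (mu : probability (borel_space T) R).
Hypothesis pm : is_pseudometric d.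
Hypothesis ib : induces_balls d.
Hypothesis Jcvg : majorizing_integral d mu delta @[delta --> 0^'+] --> 0%E.
Local Notation Jr := (majorizing_bound d mu).

(** The sequence inverts an injection of the dense set into the integers and takes the value [point]
    off its range. *)
Lemma separable_dense_seq : separable T ->
  exists z : nat -> T, forall t e, 0 < e -> exists i, d t (z i) < e.
Proof.
move=> [D /countable_injP[f f_inj] D_dense].
have [z Hz] : exists z : nat -> T, forall t, D t -> z (f t) = t.
  suff /choice[z Hz] : forall n, exists t, forall s, D s -> f s = n -> t = s.
    by exists z => t Dt; apply: Hz Dt _.
  move=> n; have [[t [Dt <-]]|H] := pselect (exists t, D t /\ f t = n).
    by exists t => s Ds fs; apply: f_inj; rewrite ?inE.
  by exists point => s Ds fs; exfalso; apply: H; exists s.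
exists z => t e e0.
have [s [/= ts Ds]] : [set y | d t y < e] `&` D !=set0.
  apply: D_dense; last exact: open_dist_lt.
  by exists t => /=; case: pm => _ -> _ _.
by exists (f s); rewrite Hz.
Qed.

(** Right continuity, needed to pass the modulus to limits. At positive [a] it follows from scaling,
    with [tau] chosen so that [tau / a * Jr a <= s]. *)
Lemma majorizing_bound_right a s : 0 <= a -> 0 < s ->
  exists2 tau, 0 < tau & Jr (a + tau) <= Jr a + s.
Proof.
move=> a0 s0; have [->|an] := eqVneq a 0.
  have [dl dl0 h] := majorizing_bound_small pm ib Jcvg s0.
  by exists dl => //; rewrite add0r (majorizing_bound0 pm ib Jcvg) add0r.
have {an}a0 : 0 < a by rewrite lt_neqAle eq_sym an.
have J0 := majorizing_bound_ge0 pm ib Jcvg a.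
have J1 : 0 < Jr a + 1 by rewrite ltr_wpDl.
exists (a * s / (Jr a + 1)); first by rewrite divr_gt0// mulr_gt0.
set tau := _ / _.
have tau0 : 0 < tau by rewrite divr_gt0// mulr_gt0.
apply: le_trans (majorizing_bound_scale pm ib Jcvg a0 (_ : a <= a + tau)) _.
  by rewrite lerDl ltW.
have -> : (a + tau) / a * Jr a = Jr a + s * (Jr a / (Jr a + 1)).
  by rewrite /tau; field; rewrite !gt_eqF.
by rewrite lerD2l ger_pMr// ler_pdivrMr// mul1r lerDl.
Qed.

Let d_ge0 x y : 0 <= d x y. Proof. by case: pm. Qed.
Let d_refl x : d x x = 0. Proof. by case: pm. Qed.
Let d_sym x y : d x y = d y x. Proof. by case: pm. Qed.
Let d_tri x y u : d x u <= d x y + d y u. Proof. by case: pm. Qed.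

Section extension.
Context (z : nat -> T) (k : T -> nat -> nat) (x : nat -> R) (dl : R).
Hypothesis dl0 : 0 < dl.
Hypothesis kz : forall t n, d t (z (k t n)) < n.+1%:R^-1.

Let inv_small (e : R) : 0 < e -> \forall n \near \oo, (n.+1%:R^-1 : R) < e.
Proof.
move=> e0; have := @cvg_harmonic R; move=> /cvgr_lt; exact.
Qed.

(** Identifies the limit with a value already given at [t]; this is what makes the extension a
    version. *)
Lemma cvg_along_approximation t v :
  (forall i, d t (z i) <= dl -> `|x i - v| <= 30 * Jr (d t (z i) / 2)) ->
  x (k t n) @[n --> \oo] --> v.
Proof.
move=> xv; apply/cvgrPdist_le => e e0.
have [dl' dl'0 Jdl'] : exists2 dl', 0 < dl' & Jr dl' <= e / 30.
  by apply: majorizing_bound_small => //; rewrite divr_gt0.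
have m0 : 0 < Num.min dl dl' by rewrite lt_min dl0.
apply: filterS (inv_small m0) => n; rewrite lt_min => /andP[n1 n2].
have h := kz t n; rewrite distrC; apply: le_trans (xv _ _) _.
  by apply/ltW/(lt_trans h).
have : Jr (d t (z (k t n)) / 2) <= Jr dl'.
  apply: le_majorizing_bound => //; move: (lt_trans h n2) => {n1 n2 h}.
  by have := d_ge0 t (z (k t n)); lra.
lra.
Qed.

Hypothesis x_mod : forall i j, d (z i) (z j) <= dl ->
  `|x i - x j| <= 30 * Jr (d (z i) (z j) / 2).

Lemma is_cvg_along_approximation t : cvgn (fun n => x (k t n)).
Proof.
apply: cauchy_cvg; apply: cauchy_exP => e /= e0.
have [dl' dl'0 Jdl'] : exists2 dl', 0 < dl' & Jr dl' <= e / 31.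
  by apply: majorizing_bound_small => //; rewrite divr_gt0.
have m0 : 0 < Num.min dl dl' / 2 by rewrite divr_gt0// lt_min dl0.
have [N _ HN] := inv_small m0.
exists (x (k t N)); exists N => // n /= Nn.
have h1 := kz t N; have h2 := kz t n.
have := HN N (leqnn N); have := HN n Nn.
rewrite /= !ltr_pdivlMr// !lt_min => /andP[a1 a2] /andP[b1 b2].
move: (N.+1%:R^-1 : R) (n.+1%:R^-1 : R) h1 h2 a1 a2 b1 b2 => u v h1 h2 a1 a2 b1 b2.
have dd : d (z (k t N)) (z (k t n)) <= Num.min dl dl'.
  rewrite le_min; have := d_tri (z (k t N)) t (z (k t n)); rewrite (d_sym (z (k t N)) t).
  by move=> ?; apply/andP; split; lra.
move: dd; rewrite le_min => /andP[dd1 dd2].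
apply: le_lt_trans (x_mod dd1) _.
have : Jr (d (z (k t N)) (z (k t n)) / 2) <= Jr dl'.
  by apply: le_majorizing_bound => //; have := d_ge0 (z (k t N)) (z (k t n)); lra.
lra.
Qed.

(** The strict inequality leaves room for the approximating points, whose distance may exceed
    [d s t] slightly; right continuity removes that excess from the bound. *)
Lemma limit_modulus s t v w : x (k s n) @[n --> \oo] --> v ->
  x (k t n) @[n --> \oo] --> w -> d s t < dl -> `|v - w| <= 30 * Jr (d s t / 2).
Proof.
move=> sv tw st; apply/ler_addgt0Pr => e e0.
have [tau tau0 Jtau] : exists2 tau, 0 < tau & Jr (d s t / 2 + tau) <= Jr (d s t / 2) + e / 30.
  by apply: majorizing_bound_right; rewrite ?divr_gt0// divr_ge0.
apply: (cvgr_to_le (cvg_norm (cvgB sv tw))).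
have m0 : 0 < Num.min (dl - d s t) (2 * tau) / 2.
  by rewrite divr_gt0// lt_min subr_gt0 st mulr_gt0.
apply: filterS (inv_small m0) => n; rewrite ltr_pdivlMr// lt_min => /andP[n1 n2].
have h1 := kz s n; have h2 := kz t n.
move: (n.+1%:R^-1 : R) h1 h2 n1 n2 => u h1 h2 n1 n2.
have dd : d (z (k s n)) (z (k t n)) <= d s t + u * 2.
  have := d_tri (z (k s n)) s (z (k t n)); have := d_tri s t (z (k t n)).
  by rewrite (d_sym (z (k s n)) s); lra.
apply: le_trans (x_mod _) _; first by lra.
have : Jr (d (z (k s n)) (z (k t n)) / 2) <= Jr (d s t / 2 + tau).
  by apply: le_majorizing_bound => //; lra.
lra.
Qed.

End extension.

(** * Boundedness, continuity and increments of squared paths *)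

Section square_paths.
Context (z : nat -> T) (G : T -> R) (dl : R).
Hypothesis z_dense : forall t e, 0 < e -> exists i, d t (z i) < e.
Hypothesis dl0 : 0 < dl.
Hypothesis G_ge0 : forall t, 0 <= G t.
Hypothesis G_mod : forall s t, d s t < dl -> `|G s - G t| <= 30 * Jr (d s t / 2).

(** A finite net of mesh [dl] reduces the bound to finitely many values, whose maximum is estimated
    by their sum. *)
Lemma sqrt_path_bounded : exists B, forall t, G t <= B.
Proof.
have [N HN] := majorizing_finite_net pm ib Jcvg z_dense dl0.
exists (\sum_(i < N) G (z i) + 30 * Jr dl) => t.
have [i iN ti] := HN t.
have h1 : G (z i) <= \sum_(j < N) G (z j).
  by rewrite (bigD1 (Ordinal iN))//= lerDl sumr_ge0.
have h2 := le_trans (ler_norm _) (G_mod ti).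
have : Jr (d t (z i) / 2) <= Jr dl.
  by apply: le_majorizing_bound => //; have := d_ge0 t (z i); lra.
lra.
Qed.

Lemma square_path_bounded : bounded_fun (fun t => G t ^+ 2).
Proof.
have [B HB] := sqrt_path_bounded.
exists (B ^+ 2); split; first exact: num_real.
move=> M BM t _ /=; rewrite ger0_norm ?sqr_ge0//; apply: le_trans (ltW BM).
by apply: lerXn2r; rewrite ?nnegrE// (le_trans (G_ge0 t)).
Qed.

Lemma square_path_continuous : continuous (fun t => G t ^+ 2).
Proof.
have GC : continuous G.
  move=> t; apply/cvgrPdist_le => e e0.
  have [dl' dl'0 Jdl'] : exists2 dl', 0 < dl' & Jr dl' <= e / 30.
    by apply: majorizing_bound_small => //; rewrite divr_gt0.
  apply/nbhs_ballP; exists (Num.min dl dl'); first by rewrite /= lt_min dl0.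
  rewrite ib ?lt_min ?dl0// => s /=; rewrite lt_min => /andP[h1 h2].
  apply: le_trans (G_mod h1) _.
  have : Jr (d t s / 2) <= Jr dl'.
    by apply: le_majorizing_bound => //; have := d_ge0 t s; lra.
  lra.
by move=> t; apply: cvgM; exact: GC.
Qed.

Let S : \bar R := ereal_sup [set (G t ^+ 2)%:E | t in [set: T]].
Let ratio := increment_ratio_sup d mu (fun t => G t ^+ 2).

(** The supremum runs over a set that grows with [delta], so the limit from the right exists by
    monotonicity. *)
Lemma increment_ratio_sup_cvg : cvg (ratio delta @[delta --> 0^'+]).
Proof.
apply: nondecreasing_at_right_is_cvge; near=> b => u v _ _ uv.
apply: ereal_sup_le => _ [p /= pu <-]; exists p => //=.
exact: le_trans uv.
Unshelve. all: by end_near. Qed.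

Lemma increment_ratio_sup_le e : e < dl -> (ratio e <= 60%:R%:E * sqrte S)%E.
Proof.
move=> edl; have [B HB] := sqrt_path_bounded.
have B0 : 0 <= B by apply: le_trans (G_ge0 point) (HB point).
have GS t : ((G t ^+ 2)%:E <= S)%E by apply: ereal_sup_ubound; exists t.
have SB : (S <= (B ^+ 2)%:E)%E.
  apply: ge_ereal_sup => _ [t _ <-]; rewrite lee_fin.
  by apply: lerXn2r; rewrite ?nnegrE.
have [r SE] : exists r, S = r%:E.
  exists (fine S); rewrite fineK// ge0_fin_numE; first by rewrite (le_lt_trans SB)// ltry.
  by apply: le_trans (GS point); rewrite lee_fin sqr_ge0.
have Gr t : G t <= Num.sqrt r.
  have := GS t; rewrite SE lee_fin => /ler_wsqrtr.
  by rewrite sqrtr_sqr ger0_norm.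
rewrite SE /=; apply: ge_ereal_sup => _ [[s t] /= st <-].
have h := G_mod (le_lt_trans st edl).
rewrite (majorizing_boundE pm ib Jcvg).
set j := Jr _ in h *; have j0 : 0 <= j by exact: majorizing_bound_ge0.
have key : `|G s ^+ 2 - G t ^+ 2| <= 60 * Num.sqrt r * j.
  rewrite subr_sqr normrM (@ger0_norm _ (G s + G t)) ?addr_ge0//.
  have -> : 60 * Num.sqrt r * j = (30 * j) * (Num.sqrt r + Num.sqrt r) by ring.
  by apply: ler_pM => //; rewrite ?addr_ge0// lerD.
(* Where the denominator vanishes, [key] makes the increment vanish too, and the quotient 0/0 is
   0. *)
have [jz|jn] := eqVneq j 0.
  move: key; rewrite jz mulr0 normr_le0 => /eqP ->.
  by rewrite normr0 mul0e -EFinM lee_fin mulr_ge0.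
by rewrite inver (negbTE jn) -!EFinM lee_fin ler_pdivrMr// lt_neqAle eq_sym jn.
Qed.

Lemma increment_ratio_sup_lim_le :
  (lim (ratio delta @[delta --> (0%R)^'+]) <= 60%:R%:E * sqrte S)%E.
Proof.
apply: lime_le; first exact: increment_ratio_sup_cvg.
near=> e; apply: increment_ratio_sup_le; near: e.
exact: nbhs_right_lt.
Unshelve. all: by end_near. Qed.

End square_paths.

End modification.

(** Superlinearity with constant [|K| / 12] absorbs the linear term into 12 times the majorizing
    bound, and 18 + 12 = 30. *)
Lemma ae_sqrt_permanental_modulus (R : realType) (T : pseudoPMetricType R)
    (d : T -> T -> R) (mu : probability (borel_space T) R)
    (dO : measure_display) (Omega : measurableType dO) (P : probability Omega R)
    (Gamma : T -> T -> R) (theta : T -> {RV P >-> R}) (z : nat -> T) :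
  is_pseudometric d -> induces_balls d ->
  majorizing_integral d mu delta @[delta --> 0^'+] --> 0%E ->
  permanental_process Gamma theta ->
  (forall x y, permanental_dist Gamma x y <= d x y) ->
  (forall t e, 0 < e -> exists i, d t (z i) < e) ->
  {ae P, forall w, exists2 dl, 0 < dl & forall i j, d (z i) (z j) <= dl ->
    `|Num.sqrt (theta (z i) w) - Num.sqrt (theta (z j) w)| <=
      30 * majorizing_bound d mu (d (z i) (z j) / 2)}.
Proof.
move=> pm ib Jcvg perm dom z_dense; have [d_ge0 _ _ _] := pm.
apply: filterS (ae_sample_modulus pm ib Jcvg z_dense perm dom) => w [K HK].
have [dl dl0 Hdl] := majorizing_bound_superlinear pm ib Jcvg (`|K| / 12).
exists dl => // i j ij; apply: le_trans (HK i j) _.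
have J0 := majorizing_bound_ge0 pm ib Jcvg (d (z i) (z j) / 2).
have KK : K * d (z i) (z j) <= `|K| * d (z i) (z j) by rewrite ler_wpM2r// ler_norm.
have [z0|zn] := eqVneq (d (z i) (z j)) 0.
  by move: KK J0; rewrite z0 !mulr0; lra.
have := Hdl (z i) (z j); rewrite lt_neqAle eq_sym zn d_ge0 => /(_ isT ij).
rewrite mulrAC ler_pdivrMr//.
lra.
Qed.

Theorem corollary1p1 (R : realType)
    (dO : measure_display) (Omega : measurableType dO) (P : probability Omega R)
    (T : pseudoPMetricType R) (Gamma : T -> T -> R) (theta : T -> {RV P >-> R})
    (d1 : T -> T -> R) (mu : probability (borel_space T) R) :
  permanental_process Gamma theta ->
  (ereal_sup [set (Gamma x x)%:E | x in [set: T]] < +oo)%E ->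
  is_pseudometric d1 ->
  induces_balls d1 ->
  (forall x y, permanental_dist Gamma x y <= d1 x y) ->
  separable T ->
  (diameter d1 < +oo)%E ->
  majorizing_integral d1 mu delta @[delta --> 0^'+] --> 0%E ->
  exists theta' : T -> {RV P >-> R},
    version_of theta theta' /\
    {ae P, forall w,
      [/\ bounded_fun (fun x => theta' x w),
          continuous (fun x => theta' x w),
          cvg (increment_ratio_sup d1 mu (fun x => theta' x w) delta
                 @[delta --> 0^'+]) &
          (lim (increment_ratio_sup d1 mu (fun x => theta' x w) delta
                 @[delta --> (0%R)^'+])
           <= 60%:R%:E * sqrte (ereal_sup [set (theta' x w)%:E | x in [set: T]]))%E]}.
Proof.
move=> perm _ pm ib dom sep _ Jcvg.
have [d_ge0 d_refl d_sym d_tri] := pm.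
have [th0 _] := perm.
have [z z_dense] := separable_dense_seq pm ib sep.
have /choice[k kz] : forall t, exists k : nat -> nat,
    forall n, d1 t (z (k n)) < n.+1%:R^-1.
  move=> t; have /choice[k hk] : forall n, exists i, d1 t (z i) < n.+1%:R^-1.
    by move=> n; apply: z_dense; rewrite invr_gt0.
  by exists k.
(* The upper limit is measurable without any exceptional set; where the roots converge, [theta'E]
   identifies it with their squared limit. *)
pose Y t w := fine (limn_esup (fun n => (theta (z (k t n)) w)%:E)).
have mY t : measurable_fun setT (Y t).
  apply: measurableT_comp => //; apply: measurable_fun_limn_esup => n.
  exact/measurable_EFinP.
pose theta' t : {RV P >-> R} := mfun_Sub (mem_set (mY t)).
have theta'E t w (v : R) : Num.sqrt (theta (z (k t n)) w) @[n --> \oo] --> v ->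
    theta' t w = v ^+ 2.
  move=> cv; rewrite -[LHS]/(Y t w) /Y.
  have cv2 : (theta (z (k t n)) w)%:E @[n --> \oo] --> (v ^+ 2)%:E.
    apply: cvg_EFin; first exact: nearW.
    rewrite (_ : _ \o _ = fun n => Num.sqrt (theta (z (k t n)) w) * Num.sqrt (theta (z (k t n)) w)).
      exact: cvgM.
    by apply/funext => n /=; rewrite -expr2 sqr_sqrtr.
  by rewrite (cvg_limn_einf_sup cv2).2.
exists theta'; split.
  (* The modulus of continuity also holds along [z] with [t] itself added. *)
  move=> t; pose zt n := if n is n'.+1 then z n' else t.
  have zt_dense s e : 0 < e -> exists i, d1 s (zt i) < e.
    by move=> /(z_dense s)[i hi]; exists i.+1.
  have ae1 : {ae P, forall w, theta' t w = theta t w}.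
    apply: filterS (ae_sqrt_permanental_modulus pm ib Jcvg perm dom zt_dense).
    move=> w [dl dl0 Hdl]; rewrite (@theta'E t w (Num.sqrt (theta t w))).
      by rewrite sqr_sqrtr.
    apply: (cvg_along_approximation pm ib Jcvg dl0 kz (x := fun i => Num.sqrt (theta (z i) w))).
    move=> i ti; rewrite distrC; exact: (Hdl 0%N i.+1 ti).
  have mE : measurable [set w | theta' t w = theta t w].
    rewrite (_ : mkset _ = setT `&` [set w | (theta' t w)%:E = (theta t w)%:E]).
      by apply: measurable_eqe => //; exact/measurable_EFinP.
    by rewrite setTI; apply/seteqP; split => w /=; [move=> ->|case].
  have P0 : P (~` [set w | theta' t w = theta t w]) = 0%E.
    by apply: measure_negligible; [exact: measurableC|exact: ae1].
  have := probability_setC P mE; rewrite P0 => h.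
  have : P [set w | theta' t w = theta t w] \is a fin_num by rewrite fin_num_measure.
  move: h; case: (P _) => // r /=; rewrite -EFinB => -[] /eqP; rewrite eq_sym subr_eq0 => /eqP <-.
  by [].
apply: filterS (ae_sqrt_permanental_modulus pm ib Jcvg perm dom z_dense) => w [dl dl0 Hdl].
have cv t : cvgn (fun n => Num.sqrt (theta (z (k t n)) w)).
  exact: (is_cvg_along_approximation pm ib Jcvg dl0 kz (x := fun i => Num.sqrt (theta (z i) w))).
(* At this fixed [w], the extension of the root from the dense sequence to all of [T]. *)
pose G t := limn (fun n => Num.sqrt (theta (z (k t n)) w)).
have G0 t : 0 <= G t by apply: limr_ge => //; apply: nearW => n; exact: sqrtr_ge0.
have GE : (fun t => theta' t w) = (fun t => G t ^+ 2).
  by apply/funext => t; exact: theta'E.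
have Gmod s t : d1 s t < dl ->
    `|G s - G t| <= 30 * majorizing_bound d1 mu (d1 s t / 2).
  exact: (limit_modulus pm ib Jcvg kz Hdl (cv s) (cv t)).
rewrite GE; split.
- exact: (square_path_bounded pm ib Jcvg z_dense dl0 G0 Gmod).
- exact: (square_path_continuous pm ib Jcvg dl0 Gmod).
- exact: increment_ratio_sup_cvg.
- have -> : [set (theta' t w)%:E | t in [set: T]] = [set (G t ^+ 2)%:E | t in [set: T]].
    by apply: eq_imagel => t _; rewrite (congr1 (@^~ t) GE).
  exact: (increment_ratio_sup_lim_le pm ib Jcvg z_dense dl0 G0 Gmod).
Qed.
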